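(* Let $Y=V\times W$ with $V=k^r$ and $W=(k^\times)^s$, and let $G$ be an algebraic torus acting diagonally on $Y$. Assume that $G$ acts transitively on $W$, and let $H$ be the stabilizer in $G$ of a point $w\in W$. Set $\mathfrak{h}=\mathrm{Lie}(H)\subseteq\mathfrak{g}=\mathrm{Lie}(G)$ and let $i^*:\mathfrak{g}^*\to\mathfrak{h}^*$ be the map obtained from the inclusion $i:\mathfrak{h}\to\mathfrak{g}$. Then there is an injective algebra homomorphism $\xi:\mathcal{D}(V)^H\to\mathcal{D}(Y)^G$ such that, whenever $\lambda\in\mathfrak{g}^*$ and $\mu=i^*(\lambda)$, the map $\xi$ induces an isomorphism $$\mathcal{B}_\mu(V)\cong\mathcal{B}_\lambda(Y),$$ where $\mathcal{B}_\lambda(Y)=\mathcal{D}(Y)^G/(\mathfrak{g}-\lambda(\mathfrak{g}))$ and $\mathcal{B}_\mu(V)=\mathcal{D}(V)^H/(\mathfrak{h}-\mu(\mathfrak{h}))$.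
   Context: $k$ is an algebraically closed field of characteristic $0$. $n=r+s$, $V=k^r$, $W=(k^\times)^s$, $Y=V\times W\subseteq k^n$. A diagonal action of a torus $G$ on $Y$ is one that extends to a diagonal action on $k^n$; it is given by an embedding of $G$ into the group $T\cong(k^\times)^n$ of diagonal matrices in $GL(n)$ (so the action is faithful). In particular $G$ preserves the factors $V$ and $W$; $H\subseteq G$ acts on $V$ by restriction. Explicitly $\mathcal{D}(Y)=k[Q_1,\ldots,Q_r,Q_{r+1}^{\pm1},\ldots,Q_n^{\pm1},P_1,\ldots,P_n]$ and $\mathcal{D}(V)=k[Q_1,\ldots,Q_r,P_1,\ldots,P_r]$, where $Q_i$ are the coordinate functions and $P_i=\partial/\partial Q_i$. If $G$ acts on the $i$-th coordinate by the character $\eta_i$, then $g\cdot Q_i=\eta_i(g)Q_i$ and $g\cdot P_i=\eta_i(g)^{-1}P_i$; superscripts denote invariants. The Lie algebra $\mathfrak{g}$ is regarded as a subspace of $\mathcal{D}(Y)^G$ via the differential of the action, $x\mapsto\sum_{j=1}^n d\eta_j(x)Q_jP_j$, and similarly $\mathfrak{h}$ is regarded as a subspace of $\mathcal{D}(V)^H$ via $x\mapsto\sum_{j=1}^r d\eta_j(x)Q_jP_j$; these elements are central in the respective invariant rings. $(\mathfrak{g}-\lambda(\mathfrak{g}))$ denotes the ideal of $\mathcal{D}(Y)^G$ generated by all $x-\lambda(x)$, $x\in\mathfrak{g}$, and $(\mathfrak{h}-\mu(\mathfrak{h}))$ denotes the ideal of $\mathcal{D}(V)^H$ generated by all $x-\mu(x)$,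 $x\in\mathfrak{h}$. *)

(* Defs.v *)
From HB Require Import structures.
From mathcomp Require Import all_boot all_order all_algebra generic_quotient.
From mathcomp Require Import finmap.
From mathcomp.classical Require Import boolp.
From mathcomp.multinomials Require Import mpoly.
From mathcomp.multinomials Require monalg.
(* The notations of monalg clash with those of mpoly.                         *)
Import -(notations) monalg.

Set Implicit Arguments.
Unset Strict Implicit.
Unset Printing Implicit Defensive.

Import Order.TTheory GRing.Theory Num.Theory.

Local Open Scope ring_scope.

Section DiagonalTorus.
Variables (k : fieldType) (n : nat).

Record torus : predArgType := Torus {
  torus_val :> 'rV[k]_n;
  torusP : [forall i, torus_val 0 i != 0] }.

HB.instance Definition _ := [isSub for torus_val].
HB.instance Definition _ := [Choice of torus by <:].

Lemma torus_neq0 (t : torus) i : t 0 i != 0.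
Proof. exact: (forallP (torusP t)). Qed.

Fact torus_one_subproof : [forall i, (const_mx 1 : 'rV[k]_n) 0 i != 0].
Proof. by apply/forallP => i; rewrite mxE oner_neq0. Qed.
Definition torus_one := Torus torus_one_subproof.

Fact torus_mul_subproof (s t : torus) :
  [forall i, (\row_j (s 0 j * t 0 j)) 0 i != 0].
Proof. by apply/forallP => i; rewrite mxE mulf_neq0 // torus_neq0. Qed.
Definition torus_mul s t := Torus (torus_mul_subproof s t).

Fact torus_inv_subproof (t : torus) : [forall i, (\row_j (t 0 j)^-1) 0 i != 0].
Proof. by apply/forallP => i; rewrite mxE invr_eq0 torus_neq0. Qed.
Definition torus_inv t := Torus (torus_inv_subproof t).

Fact torus_mulA : associative torus_mul.
Proof. by move=> s t v; apply/val_inj/rowP => i; rewrite !mxE mulrA. Qed.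
Fact torus_mul1 : left_id torus_one torus_mul.
Proof. by move=> t; apply/val_inj/rowP => i; rewrite !mxE mul1r. Qed.
Fact torus_1mul : right_id torus_one torus_mul.
Proof. by move=> t; apply/val_inj/rowP => i; rewrite !mxE mulr1. Qed.
Fact torus_mulV : left_inverse torus_one torus_inv torus_mul.
Proof.
by move=> t; apply/val_inj/rowP => i; rewrite !mxE mulVf // torus_neq0.
Qed.
Fact torus_Vmul : right_inverse torus_one torus_inv torus_mul.
Proof.
by move=> t; apply/val_inj/rowP => i; rewrite !mxE mulfV // torus_neq0.
Qed.

Arguments torus_mul : simpl never.
Arguments torus_inv : simpl never.
Arguments torus_one : simpl never.

HB.instance Definition _ := isGroup.Build torus
  torus_mulA torus_mul1 torus_1mul torus_mulV torus_Vmul.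

Lemma torusM (s t : torus) i : (s * t)%g 0 i = s 0 i * t 0 i.
Proof. by rewrite mxE. Qed.
Lemma torus1 i : (1%g : torus) 0 i = 1.
Proof. by rewrite mxE. Qed.
Lemma torusV (t : torus) i : (t^-1)%g 0 i = (t 0 i)^-1.
Proof. by rewrite mxE. Qed.

Definition regular_torus_fun (f : torus -> k) : Prop :=
  exists (p : {mpoly k[n]}) (N : nat),
    forall t, f t = p.@[t 0] / (\prod_i t 0 i) ^+ N.

End DiagonalTorus.

Arguments torus_neq0 {k n}.

(* Since T = (k^* )^n is affine, the regular functions on a closed subgroup   *)
(* are the restrictions of those of T; the last clause says that the inverse  *)
(* (phi t |-> t) is a morphism of varieties.                                  *)
Definition torus_embedding (k : fieldType) (d n : nat)
    (phi : torus k d -> torus k n) : Prop :=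
  [/\ {morph phi : s t / (s * t)%g >-> (s * t)%g},
      forall i, regular_torus_fun (fun t => phi t 0 i)
    & exists psi : 'I_d -> torus k n -> k,
        (forall j, regular_torus_fun (psi j)) /\
        (forall t j, psi j (phi t) = t 0 j)].

(* An algebraic torus acting diagonally (and faithfully) is identified with   *)
(* its image in T; the character by which g acts on the i-th coordinate is    *)
(* then g |-> g 0 i.                                                          *)
Definition diagonal_torus (k : fieldType) (n : nat) (G : {pred torus k n})
    : Prop :=
  exists (d : nat) (phi : torus k d -> torus k n),
    torus_embedding phi /\ (forall g, (g \in G) <-> exists t, g = phi t).

Section LieAlgebra.
Variables (k : fieldType) (n : nat).
Implicit Type G : {pred torus k n}.

(* The Zariski tangent space at 1 of G, inside Lie T = k^n. The differential  *)
(* of the i-th coordinate character is x |-> x 0 i.                           *)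
Definition lie_pred G : {pred 'rV[k]_n} := fun x =>
  `[< forall p : {mpoly k[n]},
        (forall g, g \in G -> p.@[g 0] = 0) ->
        \sum_i x 0 i * (p^`M(i)).@[(1%g : torus k n) 0] = 0 >].

Fact lie_pred_submod G : submod_closed (lie_pred G).
Proof.
split=> [|a x y /asboolP hx /asboolP hy]; apply/asboolP => p hp.
  by rewrite big1 // => i _; rewrite mxE mul0r.
under eq_bigr => i _ do rewrite !mxE mulrDl -mulrA.
by rewrite big_split /= -mulr_sumr hx // hy // mulr0 addr0.
Qed.

HB.instance Definition _ G :=
  GRing.isSubmodClosed.Build k 'rV[k]_n (lie_pred G) (lie_pred_submod G).

Record lie G : predArgType :=
  Lie { lie_val :> 'rV[k]_n; lieP : lie_val \in lie_pred G }.

HB.instance Definition _ G := [isSub for @lie_val G].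
HB.instance Definition _ G := [Choice of lie G by <:].
HB.instance Definition _ G := [SubChoice_isSubLmodule of lie G by <:].

Section Inclusion.
Variables (H G : {pred torus k n}) (sHG : {subset H <= G}).

Fact lie_incl_subproof (x : lie H) : (x : 'rV[k]_n) \in lie_pred G.
Proof.
case: x => x /= /asboolP hx; apply/asboolP => p hp; apply: hx => g /sHG.
exact: hp.
Qed.

Definition lie_incl (x : lie H) : lie G := Lie (lie_incl_subproof x).

Fact lie_incl_linear : linear lie_incl.
Proof. by move=> a x y; apply/val_inj. Qed.

HB.instance Definition _ :=
  GRing.isLinear.Build k (lie H) (lie G) _ lie_incl lie_incl_linear.

Definition lie_res (lambda : {scalar lie G}) : {scalar lie H} :=
  lambda \o lie_incl.

End Inclusion.
End LieAlgebra.

(* O(Y) for Y the product of lines k (u i = false) and punctured lines k^*    *)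
(* (u i = true), presented as the free k-module on the monomials Q^e.         *)
Section CoordinateRing.
Variables (k : fieldType) (n : nat) (u : pred 'I_n).

Record expo : predArgType := Expo {
  expo_val :> 'rV[int]_n;
  expoP : [forall i, u i || (0 <= expo_val 0 i)] }.

HB.instance Definition _ := [isSub for expo_val].
HB.instance Definition _ := [Choice of expo by <:].

Definition coordring := malg expo k.

HB.instance Definition _ := GRing.Lmodule.copy coordring (malg expo k).

Definition mono_expo (e : expo) : coordring := mkmalgU e 1.

(* Q^a, with junk value 0 if some Q_i that is not invertible has a_i < 0.     *)
Definition mono (a : 'rV[int]_n) : coordring :=
  if insub a is Some e then mono_expo e else 0.

Definition linext (h : expo -> coordring) (f : coordring) : coordring :=
  \sum_(e <- msupp f) mcoeff e f *: h e.

Lemma linextEw h (f : coordring) (d : {fset expo}) :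
  (msupp f `<=` d)%fset ->
  linext h f = \sum_(e <- d) mcoeff e f *: h e.
Proof.
move=> le; rewrite [LHS](big_fset_incl _ le) //= => x _ /mcoeff_outdom.
by move=> ->; rewrite scale0r.
Qed.

Fact linext_linear h : linear (linext h).
Proof.
move=> a f g.
pose d := (msupp f `|` msupp g)%fset.
have sf : (msupp f `<=` d)%fset by apply: fsubsetUl.
have sg : (msupp g `<=` d)%fset by apply: fsubsetUr.
have sfg : (msupp (a *: f + g) `<=` d)%fset.
  apply: fsubset_trans (msuppD_le _ _) _.
  by apply: fsetSU; apply: msuppZ_le.
rewrite (linextEw _ sfg) (linextEw _ sf) (linextEw _ sg) scaler_sumr -big_split.
apply: eq_bigr => e _ /=.
by rewrite mcoeffD mcoeffZ scalerDl scalerA.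
Qed.

HB.instance Definition _ h :=
  GRing.isLinear.Build k coordring coordring _ (linext h) (linext_linear h).

Lemma linextU h e : linext h (mono_expo e) = h e.
Proof.
rewrite (linextEw _ msuppU_le) big_seq_fset1 mcoeffUU.
by rewrite scale1r.
Qed.

Lemma linear_mono_ext (f g : {linear coordring -> coordring}) :
  (forall e, f (mono_expo e) = g (mono_expo e)) -> f =1 g.
Proof.
move=> fg p; rewrite [p]monalgE !raddf_sum /=; apply: eq_bigr => e _.
have -> : mkmalgU e (mcoeff e p)
   = mcoeff e p *: mono_expo e :> coordring.
  apply/malgP => e'.
  by rewrite mcoeffZ !mcoeffU mulrnAr mulr1.
by rewrite !linearZ fg.
Qed.

Record endo : Type := Endo { endo_fun :> {linear coordring -> coordring} }.

HB.instance Definition _ := gen_eqMixin endo.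
HB.instance Definition _ := gen_choiceMixin endo.

Lemma endoP (f g : endo) : f =1 g -> f = g.
Proof.
case: f g => [[f cf]] [[g cg]] /= fg; congr Endo.
have efg : f = g by apply/funext.
case: _ / efg in cg fg *; congr GRing.Linear.Pack.
case: cf cg => [[a1] [b]] [[a1'] [b']].
by rewrite (Prop_irrelevance a1 a1') (Prop_irrelevance b b').
Qed.

Lemma endo_mono_ext (f g : endo) :
  (forall e, f (mono_expo e) = g (mono_expo e)) -> f = g.
Proof. by move=> fg; apply/endoP/linear_mono_ext. Qed.

Definition endo0 : endo := Endo \0.
Definition endo1 : endo := Endo idfun.
Definition endo_opp (f : endo) : endo := Endo (\- f).
Definition endo_add (f g : endo) : endo := Endo (f \+ g).
Definition endo_mul (f g : endo) : endo := Endo (f \o g).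
Definition endo_scale (a : k) (f : endo) : endo := Endo (a \*: f).

Fact endo_addA : associative endo_add.
Proof. by move=> f g h; apply/endoP => p /=; rewrite addrA. Qed.
Fact endo_addC : commutative endo_add.
Proof. by move=> f g; apply/endoP => p /=; rewrite addrC. Qed.
Fact endo_add0 : left_id endo0 endo_add.
Proof. by move=> f; apply/endoP => p /=; rewrite add0r. Qed.
Fact endo_addN : left_inverse endo0 endo_opp endo_add.
Proof. by move=> f; apply/endoP => p /=; rewrite addNr. Qed.

HB.instance Definition _ :=
  GRing.isZmodule.Build endo endo_addA endo_addC endo_add0 endo_addN.

Fact endo_mulA : associative endo_mul.
Proof. by move=> f g h; apply/endoP. Qed.
Fact endo_1mul : left_id endo1 endo_mul.
Proof. by move=> f; apply/endoP. Qed.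
Fact endo_mul1 : right_id endo1 endo_mul.
Proof. by move=> f; apply/endoP. Qed.
Fact endo_mulDl : left_distributive endo_mul +%R.
Proof. by move=> f g h; apply/endoP. Qed.
Fact endo_mulDr : right_distributive endo_mul +%R.
Proof. by move=> f g h; apply/endoP => p /=; rewrite linearD. Qed.
Fact endo1_neq0 : endo1 != 0.
Proof.
have e0P : [forall i, u i || (0 <= (0 : 'rV[int]_n) 0 i)].
  by apply/forallP => i; rewrite mxE lexx orbT.
apply/eqP => /(congr1 (fun f : endo => f (mono_expo (Expo e0P)))) /=.
move/(congr1 (mcoeff (Expo e0P))); rewrite mcoeffUU.
by rewrite mcoeff0; apply/eqP; rewrite oner_neq0.
Qed.

HB.instance Definition _ := GRing.Zmodule_isNzRing.Build endo
  endo_mulA endo_1mul endo_mul1 endo_mulDl endo_mulDr endo1_neq0.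

Fact endo_scaleA a b (f : endo) :
  endo_scale a (endo_scale b f) = endo_scale (a * b) f.
Proof. by apply/endoP => p /=; rewrite scalerA. Qed.
Fact endo_scale1 : left_id 1 endo_scale.
Proof. by move=> f; apply/endoP => p /=; rewrite scale1r. Qed.
Fact endo_scaleDr : right_distributive endo_scale +%R.
Proof. by move=> a f g; apply/endoP => p /=; rewrite scalerDr. Qed.
Fact endo_scaleDl f : {morph endo_scale^~ f : a b / a + b}.
Proof. by move=> a b; apply/endoP => p /=; rewrite scalerDl. Qed.

HB.instance Definition _ := GRing.Zmodule_isLmodule.Build k endo
  endo_scaleA endo_scale1 endo_scaleDr endo_scaleDl.

Fact endo_scaleAl (a : k) (f g : endo) : a *: (f * g) = (a *: f) * g.
Proof. by apply/endoP. Qed.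
Fact endo_scaleAr (a : k) (f g : endo) : a *: (f * g) = f * (a *: g).
Proof. by apply/endoP => p /=; rewrite linearZ. Qed.

HB.instance Definition _ := GRing.Lmodule_isLalgebra.Build k endo endo_scaleAl.
HB.instance Definition _ := GRing.Lalgebra_isAlgebra.Build k endo endo_scaleAr.

Lemma endoE0 p : (0 : endo) p = 0. Proof. by []. Qed.
Lemma endoE1 p : (1 : endo) p = p. Proof. by []. Qed.
Lemma endoD (f g : endo) p : (f + g) p = f p + g p. Proof. by []. Qed.
Lemma endoM (f g : endo) p : (f * g) p = f (g p). Proof. by []. Qed.
Lemma endoZ a (f : endo) p : (a *: f) p = a *: f p. Proof. by []. Qed.

End CoordinateRing.

Arguments mono {k n u}.
Arguments mono_expo {k n u}.

HB.lock Definition opQ (k : fieldType) (n : nat) (u : pred 'I_n) (i : 'I_n)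
    : endo k u :=
  Endo (linext (fun e : expo u => mono ((e : 'rV[int]_n) + delta_mx 0 i))).
(* The inverse of Q_i, meaningful only when u i.                              *)
HB.lock Definition opQV (k : fieldType) (n : nat) (u : pred 'I_n) (i : 'I_n)
    : endo k u :=
  Endo (linext (fun e : expo u => mono ((e : 'rV[int]_n) - delta_mx 0 i))).
HB.lock Definition opP (k : fieldType) (n : nat) (u : pred 'I_n) (i : 'I_n)
    : endo k u :=
  Endo (linext (fun e : expo u =>
    (e 0 i)%:~R *: mono ((e : 'rV[int]_n) - delta_mx 0 i))).

(* The action of g on O(Y), normalized by g Q_i = eta_i(g) Q_i.               *)
HB.lock Definition act (k : fieldType) (n : nat) (u : pred 'I_n)
    (g : torus k n) : endo k u :=
  Endo (linext (fun e : expo u => (\prod_i g 0 i ^ e 0 i) *: mono_expo e)).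

Section DifferentialOperators.
Variables (k : fieldType) (n : nat) (u : pred 'I_n).
Local Notation endo := (endo k u).
Local Notation expo := (expo u).
Local Notation ev i := (delta_mx 0 i : 'rV[int]_n).
Local Notation opQ := (@opQ k n u).
Local Notation opQV := (@opQV k n u).
Local Notation opP := (@opP k n u).
Local Notation act := (@act k n u).

Lemma opQ_mono_expo i (e : expo) :
  opQ i (mono_expo e) = mono ((e : 'rV[int]_n) + ev i).
Proof. by rewrite opQ.unlock; exact: linextU. Qed.
Lemma opQV_mono_expo i (e : expo) :
  opQV i (mono_expo e) = mono ((e : 'rV[int]_n) - ev i).
Proof. by rewrite opQV.unlock; exact: linextU. Qed.
Lemma opP_mono_expo i (e : expo) :
  opP i (mono_expo e) = (e 0 i)%:~R *: mono ((e : 'rV[int]_n) - ev i).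
Proof. by rewrite opP.unlock; exact: linextU. Qed.
Lemma act_mono_expo g (e : expo) :
  act g (mono_expo e) = (\prod_i g 0 i ^ e 0 i) *: mono_expo e.
Proof. by rewrite act.unlock; exact: linextU. Qed.

Fact expo_add_subproof (e : expo) i :
  [forall j, u j || (0 <= ((e : 'rV[int]_n) + ev i) 0 j)].
Proof.
apply/forallP => j; rewrite !mxE.
by case: (u j) (forallP (expoP e) j) => //= e0; rewrite addr_ge0 // ler0n.
Qed.

Lemma monoE (a : 'rV[int]_n) (ha : [forall j, u j || (0 <= a 0 j)]) :
  mono a = mono_expo (Expo ha) :> coordring k u.
Proof. by rewrite /mono insubT. Qed.

Lemma opQ_mono i (a : 'rV[int]_n) : (0 <= a 0 i) || u i ->
  opQ i (mono a) = mono (a + ev i).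
Proof.
move=> ai; case: (boolP [forall j, u j || (0 <= a 0 j)]) => ha.
  by rewrite (monoE ha) opQ_mono_expo.
rewrite /mono; case: insubP => [e eP|_]; first by rewrite eP in ha.
rewrite linear0; case: insubP => // e /forallP h _; case/negP: ha.
apply/forallP => j; have := h j; rewrite !mxE eqxx /=.
by case: eqP => [-> _|_]; [rewrite orbC ai | rewrite addr0].
Qed.

Lemma opQK i : u i -> opQ i * opQV i = 1.
Proof.
move=> ui; apply: endo_mono_ext => e.
rewrite endoM opQV_mono_expo opQ_mono ?ui ?orbT // subrK.
by rewrite (monoE (expoP e)); case: e.
Qed.

Lemma opQVK i : u i -> opQV i * opQ i = 1.
Proof.
move=> ui; apply: endo_mono_ext => e.
rewrite endoM opQ_mono_expo (monoE (expo_add_subproof e i)) opQV_mono_expo /=.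
by rewrite addrK (monoE (expoP e)); case: e.
Qed.

Lemma weyl i : opP i * opQ i - opQ i * opP i = 1.
Proof.
apply: endo_mono_ext => e; rewrite endoD.
have -> : (- (opQ i * opP i)) (mono_expo e) = - (opQ i (opP i (mono_expo e))).
  by [].
rewrite endoM opQ_mono_expo (monoE (expo_add_subproof e i)) !opP_mono_expo /=.
rewrite addrK linearZ /= !mxE !eqxx.
have E : mono (e : 'rV[int]_n) = mono_expo e :> coordring k u.
  by rewrite (monoE (expoP e)); case: e.
have [->|nz] := eqVneq ((e : 'rV[int]_n) 0 i) 0.
  by rewrite scale0r subr0 add0r scale1r E.
have ge1 : (0 <= ((e : 'rV[int]_n) - ev i) 0 i) || u i.
  rewrite orbC !mxE !eqxx; case: (u i) (forallP (expoP e) i) => //= e0.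
  by rewrite subr_ge0 -gtz0_ge1 lt0r nz e0.
by rewrite (opQ_mono ge1) subrK intrD scalerDl scale1r addrAC subrr add0r E.
Qed.

(* k[Q_i, Q_j^-1 (u j), P_i], which in characteristic 0 is the whole ring of  *)
(* differential operators of Y.                                               *)
Inductive diffop : endo -> Prop :=
| diffop_Q i : diffop (opQ i)
| diffop_QV i : u i -> diffop (opQV i)
| diffop_P i : diffop (opP i)
| diffop_1 : diffop 1
| diffop_lin (a : k) D E : diffop D -> diffop E -> diffop (a *: D + E)
| diffop_mul D E : diffop D -> diffop E -> diffop (D * E).

Definition diffop_act (g : torus k n) (D : endo) : endo :=
  act g * D * act (g^-1)%g.

Lemma act_mono g a : act g (mono a) = (\prod_i g 0 i ^ a 0 i) *: mono a.
Proof.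
rewrite /mono; case: insubP => [e _ <-|_]; first exact: act_mono_expo.
by rewrite linear0 scaler0.
Qed.

Lemma actM g h : act (g * h)%g = act g * act h.
Proof.
apply: endo_mono_ext => e; rewrite endoM !act_mono_expo linearZ /= act_mono_expo.
rewrite scalerA mulrC -big_split; apply: (congr1 ( *:%R^~ _)).
by apply: eq_bigr => i _; rewrite torusM exprzMl // unitfE torus_neq0.
Qed.

Lemma act1 : act 1%g = 1.
Proof.
apply: endo_mono_ext => e; rewrite act_mono_expo big1 ?scale1r // => i _.
by rewrite torus1 exp1rz.
Qed.

Lemma actVK g : act (g^-1)%g * act g = 1.
Proof. by rewrite -actM mulVg act1. Qed.

Lemma actKV g : act g * act (g^-1)%g = 1.
Proof. by rewrite -actM mulgV act1. Qed.

Lemma diffop_act_1 g : diffop_act g 1 = 1.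
Proof. by rewrite /diffop_act mulr1 actKV. Qed.

Lemma diffop_act_M g D E :
  diffop_act g (D * E) = diffop_act g D * diffop_act g E.
Proof.
by rewrite /diffop_act !mulrA -(mulrA _ (act g^-1%g)) actVK mulr1.
Qed.

Lemma diffop_act_P g a D E :
  diffop_act g (a *: D + E) = a *: diffop_act g D + diffop_act g E.
Proof. by rewrite /diffop_act mulrDr mulrDl -scalerAr -scalerAl. Qed.

Lemma diffop_actE g (D : endo) (b : k) :
  (forall e, act g (D (mono_expo e)) =
     (b * \prod_i g 0 i ^ e 0 i) *: D (mono_expo e)) ->
  diffop_act g D = b *: D.
Proof.
move=> h; apply: (@can_inj _ _ ( *%R^~ (act g)) ( *%R^~ (act g^-1%g))).
  by move=> x; rewrite -mulrA actKV mulr1.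
rewrite /diffop_act -mulrA actVK mulr1 -scalerAl.
apply: endo_mono_ext => e; rewrite endoZ !endoM h act_mono_expo linearZ /=.
by rewrite scalerA.
Qed.

Fact prod_shift (g : torus k n) (a b : 'rV[int]_n) :
  \prod_i g 0 i ^ (a + b) 0 i =
  (\prod_i g 0 i ^ a 0 i) * \prod_i g 0 i ^ b 0 i.
Proof.
rewrite -big_split; apply: eq_bigr => i _.
by rewrite mxE expfzDr // torus_neq0.
Qed.

Fact prod_ev (g : torus k n) i : \prod_j g 0 j ^ (ev i) 0 j = g 0 i.
Proof.
rewrite (bigD1 i) //= big1 => [|j /negPf ji]; last by rewrite mxE eqxx ji expr0z.
by rewrite mulr1 mxE !eqxx expr1z.
Qed.

Fact prod_Nev (g : torus k n) i : \prod_j g 0 j ^ (- ev i) 0 j = (g 0 i)^-1.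
Proof.
rewrite (bigD1 i) //= big1 => [|j /negPf ji].
  by rewrite mulr1 !mxE !eqxx exprN1.
by rewrite !mxE eqxx ji oppr0 expr0z.
Qed.

Lemma diffop_act_Q g i : diffop_act g (opQ i) = g 0 i *: opQ i.
Proof.
apply: diffop_actE => e; rewrite opQ_mono_expo act_mono prod_shift prod_ev.
by rewrite mulrC.
Qed.

Lemma diffop_act_QV g i : diffop_act g (opQV i) = (g 0 i)^-1 *: opQV i.
Proof.
apply: diffop_actE => e; rewrite opQV_mono_expo act_mono prod_shift prod_Nev.
by rewrite mulrC.
Qed.

Lemma diffop_act_PE g i : diffop_act g (opP i) = (g 0 i)^-1 *: opP i.
Proof.
apply: diffop_actE => e; rewrite opP_mono_expo linearZ /= act_mono.
by rewrite prod_shift prod_Nev !scalerA mulrCA mulrA mulrC -mulrA.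
Qed.

Variable G : {pred torus k n}.

Definition inv_pred : {pred endo} := fun D =>
  `[< diffop D /\ forall g, g \in G -> diffop_act g D = D >].

Fact inv_subalg : subalg_closed inv_pred.
Proof.
split=> [|a D E /asboolP[dD iD] /asboolP[dE iE]|D E /asboolP[dD iD] /asboolP[dE iE]].
- by apply/asboolP; split=> [|g _]; [exact: diffop_1 | exact: diffop_act_1].
- apply/asboolP; split=> [|g gG]; first exact: diffop_lin.
  by rewrite diffop_act_P iD // iE.
- apply/asboolP; split=> [|g gG]; first exact: diffop_mul.
  by rewrite diffop_act_M iD // iE.
Qed.

HB.instance Definition _ :=
  GRing.isSubalgClosed.Build k endo inv_pred inv_subalg.

Record diffop_inv : Type :=
  DiffopInv { inv_val :> endo; invP : inv_val \in inv_pred }.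

HB.instance Definition _ := [isSub for inv_val].
HB.instance Definition _ := [Choice of diffop_inv by <:].
HB.instance Definition _ := [SubChoice_isSubAlgebra of diffop_inv by <:].

(* The differential of the action of T, on x in Lie T = k^n.                  *)
Fact euler_subproof (x : 'rV[k]_n) :
  \sum_j x 0 j *: (opQ j * opP j) \in inv_pred.
Proof.
apply: rpred_sum => j _; apply: rpredZ; apply/asboolP; split=> [|g _].
  by apply: diffop_mul; constructor.
rewrite diffop_act_M diffop_act_Q diffop_act_PE -scalerAl -scalerAr scalerA.
by rewrite mulfV ?scale1r ?torus_neq0.
Qed.

Definition euler (x : 'rV[k]_n) : diffop_inv := DiffopInv (euler_subproof x).

End DifferentialOperators.

Section QuotientAlgebra.
Variables (k : fieldType) (A : algType k) (S : A -> Prop).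

Inductive ideal_gen : A -> Prop :=
| ideal_gen_in x : S x -> ideal_gen x
| ideal_gen_0 : ideal_gen 0
| ideal_gen_D x y : ideal_gen x -> ideal_gen y -> ideal_gen (x + y)
| ideal_gen_M a x b : ideal_gen x -> ideal_gen (a * x * b).

Lemma ideal_gen_Ml a x : ideal_gen x -> ideal_gen (a * x).
Proof. by move/(ideal_gen_M a 1); rewrite mulr1. Qed.
Lemma ideal_gen_Mr b x : ideal_gen x -> ideal_gen (x * b).
Proof. by move/(ideal_gen_M 1 b); rewrite mul1r. Qed.
Lemma ideal_gen_N x : ideal_gen x -> ideal_gen (- x).
Proof. by move/(ideal_gen_Ml (-1)); rewrite mulN1r. Qed.
Lemma ideal_gen_Z c x : ideal_gen x -> ideal_gen (c *: x).
Proof. by move/(ideal_gen_Ml c%:A); rewrite mulr_algl. Qed.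

Definition ideal_equiv : rel A := fun x y => `[< ideal_gen (x - y) >].

Fact ideal_equiv_is_equiv : equiv_class_of ideal_equiv.
Proof.
split=> [x|x y|y x z].
- by apply/asboolP; rewrite subrr; exact: ideal_gen_0.
- by apply/asboolP/asboolP => /ideal_gen_N; rewrite opprB.
- move=> /asboolP xy /asboolP yz; apply/asboolP.
  by have := ideal_gen_D xy yz; rewrite addrA subrK.
Qed.

Canonical ideal_equiv_rel := EquivRelPack ideal_equiv_is_equiv.

Definition quot_alg := {eq_quot ideal_equiv_rel}%qT.

HB.instance Definition _ : EqQuotient A ideal_equiv_rel quot_alg :=
  EqQuotient.on quot_alg.
HB.instance Definition _ := Choice.on quot_alg.

Definition quot_pi : A -> quot_alg := (\pi_quot_alg)%qT.

Lemma quot_piP x y : quot_pi x = quot_pi y <-> ideal_gen (x - y).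
Proof.
split=> [/eqmodP/asboolP //|h]; apply/eqmodP/asboolP; exact: h.
Qed.

Lemma quot_piK (q : quot_alg) : quot_pi (repr q) = q.
Proof. exact: reprK. Qed.

Lemma quot_reprK x : ideal_gen (repr (quot_pi x) - x).
Proof. by apply/quot_piP; rewrite quot_piK. Qed.

Definition quot_opp (p : quot_alg) := quot_pi (- repr p).
Definition quot_add (p q : quot_alg) := quot_pi (repr p + repr q).
Definition quot_mul (p q : quot_alg) := quot_pi (repr p * repr q).
Definition quot_scale (c : k) (p : quot_alg) := quot_pi (c *: repr p).

Fact quot_oppE x : quot_opp (quot_pi x) = quot_pi (- x).
Proof.
by apply/quot_piP; have /ideal_gen_N := quot_reprK x; rewrite opprB opprK addrC.
Qed.
Fact quot_addE x y : quot_add (quot_pi x) (quot_pi y) = quot_pi (x + y).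
Proof.
by apply/quot_piP; rewrite opprD addrACA; apply: ideal_gen_D; apply: quot_reprK.
Qed.
Fact quot_mulE x y : quot_mul (quot_pi x) (quot_pi y) = quot_pi (x * y).
Proof.
apply/quot_piP; set x' := repr _; set y' := repr _.
have -> : x' * y' - x * y = (x' - x) * y' + x * (y' - y).
  by rewrite mulrBl mulrBr addrA subrK.
apply: ideal_gen_D; first exact/ideal_gen_Mr/quot_reprK.
exact/ideal_gen_Ml/quot_reprK.
Qed.
Fact quot_scaleE c x : quot_scale c (quot_pi x) = quot_pi (c *: x).
Proof. by apply/quot_piP; rewrite -scalerBr; apply/ideal_gen_Z/quot_reprK. Qed.

Local Ltac lift_quot :=
  repeat match goal with
    q : quot_alg |- _ => rewrite -(quot_piK q); move: (repr q); clear q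
  end; move=> *; rewrite !(quot_oppE, quot_addE, quot_mulE, quot_scaleE).

Fact quot_addA : associative quot_add.
Proof. by move=> p q r; lift_quot; rewrite addrA. Qed.
Fact quot_addC : commutative quot_add.
Proof. by move=> p q; lift_quot; rewrite addrC. Qed.
Fact quot_add0 : left_id (quot_pi 0) quot_add.
Proof. by move=> p; lift_quot; rewrite add0r. Qed.
Fact quot_addN : left_inverse (quot_pi 0) quot_opp quot_add.
Proof. by move=> p; lift_quot; rewrite addNr. Qed.

HB.instance Definition _ :=
  GRing.isZmodule.Build quot_alg quot_addA quot_addC quot_add0 quot_addN.

Fact quot_mulA : associative quot_mul.
Proof. by move=> p q r; lift_quot; rewrite mulrA. Qed.
Fact quot_1mul : left_id (quot_pi 1) quot_mul.
Proof. by move=> p; lift_quot; rewrite mul1r. Qed.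
Fact quot_mul1 : right_id (quot_pi 1) quot_mul.
Proof. by move=> p; lift_quot; rewrite mulr1. Qed.
Fact quot_mulDl : left_distributive quot_mul quot_add.
Proof. by move=> p q r; lift_quot; rewrite mulrDl. Qed.
Fact quot_mulDr : right_distributive quot_mul quot_add.
Proof. by move=> p q r; lift_quot; rewrite mulrDr. Qed.

(* The ideal need not be proper: the quotient is only a possibly-zero ring,   *)
(* hence not an algType.                                                      *)
HB.instance Definition _ := GRing.Zmodule_isPzRing.Build quot_alg
  quot_mulA quot_1mul quot_mul1 quot_mulDl quot_mulDr.

Fact quot_scaleA a b (p : quot_alg) :
  quot_scale a (quot_scale b p) = quot_scale (a * b) p.
Proof. by lift_quot; rewrite scalerA. Qed.
Fact quot_scale1 : left_id 1 quot_scale.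
Proof. by move=> p; lift_quot; rewrite scale1r. Qed.
Fact quot_scaleDr : right_distributive quot_scale quot_add.
Proof. by move=> a p q; lift_quot; rewrite scalerDr. Qed.
Fact quot_scaleDl p : {morph quot_scale^~ p : a b / a + b >-> quot_add a b}.
Proof. by move=> a b; lift_quot; rewrite scalerDl. Qed.

HB.instance Definition _ := GRing.Zmodule_isLmodule.Build k quot_alg
  quot_scaleA quot_scale1 quot_scaleDr quot_scaleDl.

End QuotientAlgebra.

Definition alg_iso (k : fieldType) (A B : algType k) (S : A -> Prop)
    (S' : B -> Prop) (phi : quot_alg S -> quot_alg S') : Prop :=
  [/\ linear phi, monoid_morphism phi & bijective phi].

Section Setting.
Variables (k : fieldType) (r s : nat).
Implicit Type G : {pred torus k (r + s)}.

Fact torus_V_subproof (g : torus k (r + s)) :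
  [forall i, (lsubmx g : 'rV[k]_r) 0 i != 0].
Proof. by apply/forallP => i; rewrite mxE torus_neq0. Qed.
Definition torus_V g := Torus (torus_V_subproof g).

Fact torus_W_subproof (g : torus k (r + s)) :
  [forall i, (rsubmx g : 'rV[k]_s) 0 i != 0].
Proof. by apply/forallP => i; rewrite mxE torus_neq0. Qed.
Definition torus_W g := Torus (torus_W_subproof g).

(* The points of W = (k^* )^s are those of torus k s, on which g acts through *)
(* multiplication by its last s coordinates.                                  *)
Definition transitive_W G : Prop :=
  forall w w' : torus k s, exists2 g, g \in G & (torus_W g * w)%g = w'.

Definition stab G (w : torus k s) : {pred torus k (r + s)} :=
  [pred g in G | (torus_W g * w)%g == w].

Lemma stab_sub G w : {subset stab G w <= G}.
Proof. by move=> g /andP[]. Qed.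

Definition image_V (H : {pred torus k (r + s)}) : {pred torus k r} := fun t =>
  `[< exists2 h, h \in H & t = torus_V h >].

Definition unitsV : pred 'I_r := pred0.
Definition unitsY : pred 'I_(r + s) := fun i => (r <= i)%N.

(* H acts on V by restriction, i.e. through its first r coordinates.          *)
Definition DV_inv (H : {pred torus k (r + s)}) := diffop_inv unitsV (image_V H).
Definition DY_inv G := diffop_inv unitsY G.

HB.instance Definition _ H := GRing.Algebra.on (DV_inv H).
HB.instance Definition _ G := GRing.Algebra.on (DY_inv G).

Definition moment_V (H : {pred torus k (r + s)}) (x : lie H) : DV_inv H :=
  euler unitsV (image_V H) (lsubmx x).
Definition moment_Y G (x : lie G) : DY_inv G := euler unitsY G x.

Definition shifted_V (H : {pred torus k (r + s)}) (mu : {scalar lie H})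
    : DV_inv H -> Prop :=
  fun D => exists x, D = moment_V x - (mu x)%:A.
Definition shifted_Y G (lambda : {scalar lie G}) : DY_inv G -> Prop :=
  fun D => exists x, D = moment_Y x - (lambda x)%:A.

Definition B_V H (mu : {scalar lie H}) := quot_alg (shifted_V mu).
Definition B_Y G (lambda : {scalar lie G}) := quot_alg (shifted_Y lambda).

End Setting.

(* Main.v *)
Require Import Defs.
From HB Require Import structures.
From mathcomp Require Import all_boot all_order all_algebra.
From mathcomp Require Import cyclic separable cyclotomic finmap.
From mathcomp.classical Require Import boolp.
From mathcomp.multinomials Require Import mpoly.

Set Implicit Arguments.
Unset Strict Implicit.
Unset Printing Implicit Defensive.
Import Order.TTheory GRing.Theory Num.Theory.
Local Open Scope ring_scope.

(* Let N be the lattice of the characters of T that are trivial on G. As G    *)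
(* acts transitively on W, the projection of N to the characters of the first *)
(* r coordinates is injective, and by the Smith normal form its image is the  *)
(* set of the characters trivial on H. Hence every weight a of D(V)^H has a   *)
(* unique companion b with (a, b) in N, and xi multiplies the component of    *)
(* weight a by Q_W^b. Conversely an element of D(Y)^G is a sum of terms       *)
(* xi(D) q(Q_j P_j : j > r) with q a polynomial. As g maps onto Lie(W), with  *)
(* kernel h, there are x_j in g with x_j - Q_(r+j) P_(r+j) in xi(D(V)^H), so  *)
(* xi is surjective modulo g - lambda(g). It is injective because mapping x_j *)
(* to lambda(x_j) defines a retraction of xi sending g - lambda(g) into the   *)
(* ideal generated by h - mu(h); to see that this retraction is well defined, *)
(* let D(Y)^G act on monomials Q_V^e Q_W^v: the coefficients are polynomial   *)
(* in v, hence may be evaluated at non-integral v.                            *)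

(** * Characters of tori *)

(** Write a character of T as a pair (a, b) of exponents on V and on W. Among the pairs trivial on
    G, transitivity on W makes b a function of a ([trivial_on_W]), and the a that occur are exactly
    the characters trivial on H ([stab_trivial_lift], [trivial_on_stab]). Since this function is
    additive, [xi] is multiplicative. These lattice facts, and the description of Lie algebras by
    trivial characters ([lie_predP]), rest on the independence of characters and on the Smith normal
    form.

    Put theta_j = Q_(r+j) P_(r+j). Every element of D(Y) is a sum of terms D Q_W^b q(theta) with D
    homogeneous of weight a in D(V) and q a polynomial ([diffop_twist_sum]). If (a, b) is trivial on
    G, such a term is xi(D) q(theta). The map from g to Lie(W) is onto with kernel h ([lie_lift_W],
    [lie_stabP]), so theta_j differs from the moment of some x_j in g by an element of the image of
    [xi]. Thus D(Y)^G is generated by that image and the central elements x_j, and replacing x_j by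
    lambda(x_j) shows that [xi] is onto modulo the ideal ([rel_total], [rel_mod_ideal]).

    Injectivity comes from the retraction of [xi] that sends x_j to lambda(x_j). It is introduced as
    a relation [rel], and the delicate point is that it is single-valued ([rel_functional]): it is
    realized by specializing v in the matrix coefficients on Q_V^e Q_W^v, which are polynomial in v
    ([nf], [nf_functional]). It maps the ideal of lambda into that of mu ([rel_ideal]), whence
    [xi_ideal_inj]. *)

Section Characters.
Variables (k : fieldType) (T : Type) (op : T -> T -> T).

Definition character (f : T -> k) : Prop :=
  (forall x y, f (op x y) = f x * f y) /\ exists x, f x != 0.

(** Dedekind's argument: subtracting [f0 y] times the relation at [x] from the relation at [op y x]
    eliminates [f0] and leaves a shorter relation. *)
Lemma characters_free (fs : seq (T -> k)) (c : (T -> k) -> k) :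
  uniq fs -> (forall f, f \in fs -> character f) ->
  (forall x, \sum_(f <- fs) c f * f x = 0) ->
  forall f, f \in fs -> c f = 0.
Proof.
elim: fs c => //= f0 fs IH c /andP[f0fs ufs] hfs h0.
have c0 f : f \in fs -> c f = 0.
  move=> ffs; have /existsNP[y fy] : ~ forall y, f y = f0 y.
    by move/funext => ff0; rewrite -ff0 ffs in f0fs.
  have := IH (fun f => c f * (f y - f0 y)) ufs _ _ f ffs.
  have hyp x : \sum_(f <- fs) c f * (f y - f0 y) * f x = 0.
    have [f0M _] := hfs f0 (mem_head _ _).
    have h1 := h0 (op y x); have h2 := h0 x.
    rewrite big_cons f0M in h1; rewrite big_cons in h2.
    transitivity ((c f0 * (f0 y * f0 x) + \sum_(g <- fs) c g * g (op y x)) -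
       f0 y * (c f0 * f0 x + \sum_(g <- fs) c g * g x)); last first.
      by rewrite h1 h2 mulr0 subr0.
    rewrite mulrDr [c f0 * _]mulrCA opprD addrACA subrr add0r mulr_sumr -sumrB.
    rewrite [LHS]big_seq [RHS]big_seq; apply: eq_bigr => g gfs.
    have [gM _] : character g by apply: hfs; rewrite inE gfs orbT.
    by rewrite gM mulrBr mulrBl mulrA [f0 y * _]mulrCA mulrA.
  move/(_ (fun g gfs => hfs g (mem_behead (gfs : g \in behead (f0 :: fs)))) hyp).
  move/eqP; rewrite mulf_eq0 subr_eq0 => /orP[/eqP//|/eqP //].
move=> f; rewrite inE => /predU1P[->|]; last exact: c0.
have [_ [x fx]] := hfs f0 (mem_head _ _).
have := h0 x; rewrite big_cons big_seq big1 ?addr0 => [/eqP|g gfs].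
  by rewrite mulf_eq0 (negPf fx) orbF => /eqP.
by rewrite c0 ?mul0r.
Qed.

(* By linear independence, the coefficients of the copies of each character   *)
(* add up to 0.                                                               *)
Lemma characters_relation (I : eqType) (r : seq I) (chi : I -> T -> k)
    (c v : I -> k) :
  (forall i, character (chi i)) ->
  (forall i j, chi i = chi j -> v i = v j) ->
  (forall x, \sum_(i <- r) c i * chi i x = 0) ->
  \sum_(i <- r) c i * v i = 0.
Proof.
move=> hchi hv h0; pose fs := undup (map chi r).
have ufs : uniq fs by apply: undup_uniq.
have part (F : I -> k) :
    \sum_(i <- r) F i = \sum_(f <- fs) \sum_(i <- r | chi i == f) F i.
  rewrite (exchange_big_dep predT) //=; rewrite [LHS]big_seq [RHS]big_seq.
  apply: eq_bigr => i ir; rewrite -big_filter (perm_big [:: chi i]) ?big_seq1 //.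
  apply: uniq_perm; rewrite ?filter_uniq // => f; rewrite mem_filter inE eq_sym.
  by case: eqP => [->|]; rewrite ?mem_undup ?map_f //.
have c0 f : f \in fs -> \sum_(i <- r | chi i == f) c i = 0.
  move: f; apply: (characters_free (c := fun f => \sum_(i <- r | chi i == f) c i)) => //.
    by move=> f; rewrite mem_undup => /mapP[i _ ->].
  move=> x; rewrite -[RHS](h0 x) [RHS]part; apply: eq_bigr => f _.
  by rewrite mulr_suml; apply: eq_bigr => i /eqP <-.
rewrite part big_seq big1 // => f ffs.
move: (ffs); rewrite mem_undup => /mapP[j jr fj].
rewrite (eq_bigr (fun i => c i * v j)) => [|i /eqP chii].
  by rewrite -mulr_suml c0 ?mul0r.
by congr (_ * _); apply: hv; rewrite chii.
Qed.

End Characters.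

Section CharacteristicZero.
Variables (k : closedFieldType) (char0 : [pchar k] =i pred0).

Lemma pchar0_natr_eq0 (n : nat) : (n%:R == 0 :> k) = (n == 0)%N.
Proof. by have /pcharf0P -> := char0. Qed.

Lemma pchar0_intr_eq0 (m : int) : (m%:~R == 0 :> k) = (m == 0).
Proof.
by case: m => n; rewrite ?NegzE ?mulrNz ?oppr_eq0 pchar0_natr_eq0.
Qed.

Lemma pchar0_intr_inj : injective (intr : int -> k).
Proof.
by move=> m n /eqP; rewrite -subr_eq0 -intrB pchar0_intr_eq0 subr_eq0 => /eqP.
Qed.

Lemma pchar0_two_neq0 : 2%:R != 0 :> k.
Proof. by rewrite pchar0_natr_eq0. Qed.

(** Since 2 has infinite multiplicative order in characteristic 0, one evaluation at 2 detects
    whether an exponent is zero. *)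
Lemma exp2z_eq1 (c : int) : (2%:R : k) ^ c = 1 -> c = 0.
Proof.
have exp2n n : (2%:R : k) ^+ n = 1 -> n = 0%N.
  move=> /eqP; rewrite -natrX -subr_eq0 -(natrB _ (expn_gt0 2 n)) pchar0_natr_eq0.
  by rewrite subn_eq0; case: n => // n; rewrite leqNgt -(expn0 2) ltn_exp2l.
case: c => n; first by rewrite -exprnP => /exp2n ->.
by rewrite NegzE -exprnN => /eqP; rewrite invr_eq1 => /eqP/exp2n.
Qed.

Lemma prim_root_exists n : (n > 0)%N -> exists z : k, n.-primitive_root z.
Proof.
pose p : {poly k} := 'X^n - 1; have [r Dp] := closed_field_poly_normal p.
move=> n_gt0; rewrite (monicP _) ?monicXnsubC // scale1r in Dp.
have rn1 : all n.-unity_root r by apply/allP=> z; rewrite -root_prod_XsubC -Dp.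
have sz_r : (n < (size r).+1)%N.
  by rewrite -(size_prod_XsubC r id) -Dp size_XnsubC.
have [|z] := hasP (has_prim_root n_gt0 rn1 _ sz_r); last by exists z.
by rewrite -separable_prod_XsubC -Dp separable_Xn_sub_1 // pchar0_natr_eq0 -lt0n.
Qed.

(** For nonzero [e] it suffices to test a primitive root of unity of order [|e|]; for [e = 0] every
    nonzero [z] is allowed, and [z = 2] forces [c = 0]. *)
Lemma expz_roots_dvd (e c : int) :
  (forall z : k, z != 0 -> z ^ e = 1 -> z ^ c = 1) -> exists y, c = y * e.
Proof.
move=> h; have [e0|e0] := eqVneq e 0.
  by exists 0; rewrite mul0r; apply/exp2z_eq1/h; rewrite ?pchar0_two_neq0 ?e0.
have n_gt0 : (`|e| > 0)%N by rewrite absz_gt0.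
have [z zP] := prim_root_exists n_gt0.
have z0 : z != 0 by rewrite (prim_root_eq0 zP) -lt0n.
have zabs (m : int) : (z ^ m == 1) = (z ^+ `|m| == 1).
  by case: m => m //=; rewrite NegzE -exprnN invr_eq1.
have /h : z ^ e = 1 by apply/eqP; rewrite zabs (prim_expr_order zP).
move/(_ z0)/eqP; rewrite zabs -(prim_order_dvd zP) => ec.
exact: (dvdzP (ec : (e %| c)%Z)).
Qed.

End CharacteristicZero.

Section TorusCharacters.
Variables (k : fieldType) (n : nat).
Implicit Types (t g h : torus k n) (a b : 'rV[int]_n).

Definition tpow t a : k := \prod_i t 0 i ^ a 0 i.

Lemma tpow_neq0 t a : tpow t a != 0.
Proof. by apply/prodf_neq0 => i _; rewrite expfz_neq0 // torus_neq0. Qed.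

Lemma tpow0 t : tpow t 0 = 1.
Proof. by apply: big1 => i _; rewrite mxE expr0z. Qed.

Lemma tpowD t a b : tpow t (a + b) = tpow t a * tpow t b.
Proof. exact: prod_shift. Qed.

Lemma tpowZ t z a : tpow t (z *: a) = tpow t a ^ z.
Proof.
rewrite /tpow (big_morph _ (fun x y => expfzMl x y z) (exp1rz k z)).
by apply: eq_bigr => i _; rewrite mxE exprz_exp mulrC.
Qed.

Lemma tpowN t a : tpow t (- a) = (tpow t a)^-1.
Proof. by rewrite -scaleN1r tpowZ exprN1. Qed.

Lemma tpowM g h a : tpow (g * h)%g a = tpow g a * tpow h a.
Proof.
by rewrite -big_split; apply: eq_bigr => i _; rewrite torusM expfzMl.
Qed.

Lemma tpow_delta t i : tpow t (delta_mx 0 i) = t 0 i.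
Proof. exact: prod_ev. Qed.

Lemma tpow_character a : character (fun s t => (s * t)%g) (tpow^~ a).
Proof.
by split=> [s t|]; [rewrite tpowM | exists 1%g; rewrite tpow_neq0].
Qed.

Fact torus_point_subproof (i : 'I_n) (z : k) :
  [forall j, (\row_j (if (j == i) && (z != 0) then z else 1)) 0 j != 0].
Proof.
apply/forallP => j; rewrite mxE; case: ifP => [/andP[]//|_].
exact: oner_neq0.
Qed.
(** The test [z != 0] in its entries makes this one-parameter subgroup total in [z]. *)
Definition torus_point i z := Torus (torus_point_subproof i z).

Lemma tpow_point i z a : z != 0 -> tpow (torus_point i z) a = z ^ a 0 i.
Proof.
move=> z0; rewrite /tpow (bigD1 i) //= mxE eqxx z0 big1 ?mulr1 // => j /negPf ji.
by rewrite mxE ji /= exp1rz.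
Qed.

Definition trivial_on (K : {pred torus k n}) a : Prop :=
  forall g, g \in K -> tpow g a = 1.

Lemma trivial_on0 K : trivial_on K 0. Proof. by move=> g _; rewrite tpow0. Qed.

Lemma trivial_onD K a b :
  trivial_on K a -> trivial_on K b -> trivial_on K (a + b).
Proof. by move=> ha hb g gK; rewrite tpowD ha // hb // mulr1. Qed.

Lemma trivial_onN K a : trivial_on K a -> trivial_on K (- a).
Proof. by move=> ha g gK; rewrite tpowN ha // invr1. Qed.

Lemma trivial_onB K a b :
  trivial_on K a -> trivial_on K b -> trivial_on K (a - b).
Proof. by move=> ha hb; apply/trivial_onD/trivial_onN. Qed.

End TorusCharacters.

Arguments tpow {k n}.

Section MonomialMaps.
Variables (k : fieldType) (n d : nat).
Implicit Types (u : torus k d) (M : 'M[int]_(n, d)).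

Fact torus_mx_subproof u M :
  [forall i, (\row_i tpow u (row i M)) 0 i != 0].
Proof. by apply/forallP => i; rewrite mxE tpow_neq0. Qed.
(** The homomorphism of tori that acts on exponent vectors, by pullback, as right multiplication by
    [M]. *)
Definition torus_mx u M := Torus (torus_mx_subproof u M).

Lemma tpow_mulmx u M a : tpow u (a *m M) = \prod_i tpow u (row i M) ^ a 0 i.
Proof.
rewrite mulmx_sum_row (big_morph _ (tpowD u) (tpow0 u)).
by apply: eq_bigr => i _; rewrite tpowZ.
Qed.

Lemma tpow_torus_mx u M a : tpow (torus_mx u M) a = tpow u (a *m M).
Proof. by rewrite tpow_mulmx; apply: eq_bigr => i _; rewrite mxE. Qed.

End MonomialMaps.

Section Monomials.
Variables (k : fieldType) (n : nat).

Definition mnm_row (m : 'X_{1..n}) : 'rV[int]_n := \row_i (m i)%:Z.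

Lemma tpow_mnm (t : torus k n) m : tpow t (mnm_row m) = \prod_i t 0 i ^+ m i.
Proof. by apply: eq_bigr => i _; rewrite mxE. Qed.

(** A regular function is a combination of Laurent monomials, which are characters; a character
    different from all of them would be independent of them. *)
Lemma regular_character_monomial (f : torus k n -> k) :
  character (fun s t => (s * t)%g) f -> regular_torus_fun f ->
  exists a, f = tpow^~ a.
Proof.
move=> fchar [p [N fp]]; apply: contrapT => /forallNP nof.
(* [None] stands for [f] and [Some m] for the Laurent monomial of exponent [m - N]; as [v] singles
   out [None], the relation would give 1 = 0. *)
pose chi (o : option 'X_{1..n}) :=
  if o is Some m then (@tpow k n)^~ (mnm_row m - const_mx N%:Z) else f.
pose c (o : option 'X_{1..n}) := if o is Some m then - p@_m else 1.
pose v (o : option 'X_{1..n}) : k := if o is Some m then 0 else 1.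
have /eqP : \sum_(o <- None :: map some (msupp p)) c o * v o = 0; last first.
  rewrite big_cons big_map /= mulr1 big1 => [|m _]; last by rewrite mulr0.
  by rewrite addr0 oner_eq0.
apply: (characters_relation (op := fun s t => (s * t)%g) (chi := chi)).
- by case=> [m|] //; exact: tpow_character.
- case=> [m|] [m'|] //=; first by move=> /esym/nof.
  by move/nof.
move=> t; rewrite big_cons big_map /= mul1r fp mevalE mulr_suml -big_split.
rewrite big1 //= => m _; rewrite tpowD tpow_mnm tpowN mulNr -mulrA.
suff -> : tpow t (const_mx N%:Z) = (\prod_i t 0 i) ^+ N by rewrite subrr.
by rewrite -prodrXl; apply: eq_bigr => i _; rewrite mxE.
Qed.

Lemma mderiv_sum_at1 (p : {mpoly k[n]}) (x : 'rV[k]_n) :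
  \sum_i x 0 i * (p^`M(i)).@[(1%g : torus k n) 0] =
  \sum_(m <- msupp p) p@_m * \sum_i (mnm_row m 0 i)%:~R * x 0 i.
Proof.
under [RHS]eq_bigr do rewrite mulr_sumr.
rewrite exchange_big; apply: eq_bigr => i _ /=.
rewrite /mderiv linear_sum mulr_sumr; apply: eq_bigr => m _.
rewrite /= mevalZ mevalX big1 => [|j _]; last by rewrite torus1 expr1n.
by rewrite mulr1 mxE mulrC [RHS]mulrA [p@_m * _]mulrC.
Qed.

(** A trivial character gives a binomial vanishing on [K]. Conversely, a polynomial vanishing on [K]
    is a linear relation between characters of [K], and the relation persists when each character is
    replaced by its derivative along [x], which by hypothesis depends only on its restriction to
    [K]. *)
Lemma lie_predP (K : {pred torus k n}) (x : 'rV[k]_n) :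
  (exists g, g \in K) -> (forall g h, g \in K -> h \in K -> (g * h)%g \in K) ->
  (x \in lie_pred K) <->
  (forall a, trivial_on K a -> \sum_i (a 0 i)%:~R * x 0 i = 0).
Proof.
move=> [g0 g0K] KM; split=> [/asboolP hx a ha|hx].
  (* The positive and negative parts of [a], so that the binomial ['X_[ap] - 'X_[an]] vanishes on
     [K]. *)
  pose ap : 'X_{1..n} :=
    [multinom (if (0 <= a 0%R i)%R then `|a 0%R i|%N else 0%N) | i < n].
  pose an : 'X_{1..n} :=
    [multinom (if (0 <= a 0%R i)%R then 0%N else `|a 0%R i|%N) | i < n].
  have aE : mnm_row ap = a + mnm_row an.
    apply/rowP => i; rewrite !mxE !mnmE; case: ifP => [a0|/negbT].
      by rewrite addr0 gez0_abs.
    by rewrite -ltNge => a0; rewrite ltz0_abs // addrN.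
  have := hx ('X_[ap] - 'X_[an]) _; rewrite (eq_bigr (fun i =>
    x 0 i * ('X_[ap]^`M(i)).@[(1%g : torus k n) 0] -
    x 0 i * ('X_[an]^`M(i)).@[(1%g : torus k n) 0])); last first.
    by move=> i _; rewrite linearB mevalB mulrBr.
  rewrite sumrB !mderiv_sum_at1 !msuppX !big_seq1 !mcoeffX !eqxx !mul1r -sumrB.
  rewrite aE => h; rewrite -[RHS]h => [|g gK].
    by apply: eq_bigr => i _; rewrite mxE intrD mulrDl addrK.
  by rewrite mevalB !mevalX -!tpow_mnm aE tpowD ha // mul1r subrr.
apply/asboolP => p hp; rewrite mderiv_sum_at1.
pose op (g h : {g | g \in K}) : {g | g \in K} :=
  exist _ (val g * val h)%g (KM _ _ (valP g) (valP h)).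
apply: (@characters_relation _ _ op _ _
  (fun m g => tpow (val g) (mnm_row m)) (fun m => p@_m)).
- move=> m; split=> [g h|]; first by rewrite /= tpowM.
  by exists (exist _ g0 g0K); rewrite tpow_neq0.
- move=> m m' mm'; apply/eqP; rewrite -subr_eq0 -sumrB; apply/eqP.
  rewrite -[RHS](hx (mnm_row m - mnm_row m')) => [|g gK].
    by apply: eq_bigr => i _; rewrite !mxE intrB mulrBl.
  have /(congr1 (@^~ (exist _ g gK))) /= := mm'.
  by rewrite tpowD tpowN => ->; rewrite divff ?tpow_neq0.
- move=> [g gK] /=; rewrite -[RHS](hp g gK) mevalE.
  by apply: eq_bigr => m _; rewrite tpow_mnm.
Qed.

End Monomials.

(** * Consequences of the Smith normal form *)

Section SmithConsequences.
Variables (k : closedFieldType) (char0 : [pchar k] =i pred0).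
Variables (s d : nat) (B : 'M[int]_(s, d)).

Let diag_int (D : seq int) : 'M[int]_(s, d) :=
  \matrix_(i, j) (D`_i *+ (i == j :> nat)).

(** After base changes over the integers [B] is diagonal, its kernel is a product of groups of roots
    of unity and full factors, and the claim becomes divisibility in each coordinate. *)
Lemma trivial_on_monomial_kernel (c : 'rV[int]_d) :
  (forall t : torus k d, (forall j, tpow t (row j B) = 1) -> tpow t c = 1) ->
  exists b, c = b *m B.
Proof.
move=> hc; have [L Lu [R Ru [D _ BE]]] := int_Smith_normal_form B.
rewrite -/(diag_int D) in BE; set c' := c *m invmx R.
have hc' (u : torus k d) :
    (forall j, tpow u (row j (diag_int D)) = 1) -> tpow u c' = 1.
  move=> hu; have := hc (torus_mx u (invmx R)); rewrite tpow_torus_mx.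
  apply=> j; rewrite tpow_torus_mx -row_mul BE mulmxK // row_mul tpow_mulmx.
  by apply: big1 => i _; rewrite hu exp1rz.
(* For [i >= s] no row constrains the coordinate [i]; the exponent 0 encodes this and forces
   [c' 0 i = 0]. *)
have dvd (i : 'I_d) : exists y : int, c' 0 i = y * (if (i < s)%N then D`_i else 0).
  apply: (expz_roots_dvd char0) => z z0 ze; rewrite -(tpow_point _ c' z0).
  apply: hc' => j; rewrite tpow_point // !mxE.
  have [ji|] := eqVneq (j : nat) i; last by rewrite mulr0n expr0z.
  by rewrite -ze -ji ltn_ord mulr1n.
have [y yP] := choice dvd.
(* Rows of index at least [d] of the diagonal matrix are zero; their coefficient is arbitrary, here
   0. *)
pose b : 'rV[int]_s :=
  \row_j (if insub (j : nat) is Some i then y i else 0).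
exists (b *m invmx L); rewrite BE -!mulmxA mulKmx // mulmxA.
suff -> : b *m diag_int D = c' by rewrite mulmxKV.
apply/rowP => i; rewrite yP mxE.
have [si|si] := leqP s i.
  rewrite mulr0 big1 // => j _; rewrite !mxE.
  case: eqP => [ji|]; last by rewrite mulr0.
  by rewrite -ji leqNgt ltn_ord in si.
rewrite (bigD1 (Ordinal si)) //= big1 => [|j ji]; rewrite !mxE.
  rewrite eqxx mulr1n addr0; case: insubP => [i0 _ i0E|]; last by rewrite /= ltn_ord.
  by congr (y _ * _); apply: val_inj.
case: eqP => [eji|]; last by rewrite mulr0.
by case/eqP: ji; apply: val_inj.
Qed.

(** Injectivity over the integers makes all [s] Smith invariants nonzero, hence invertible in [k];
    [E] is then a right inverse of the diagonal form. *)
Lemma intr_mulmx_surjective (v : 'cV[k]_s) :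
  (forall b : 'rV[int]_s, b *m B = 0 -> b = 0) ->
  exists y : 'cV[k]_d, map_mx intr B *m y = v.
Proof.
move=> Binj; have [L Lu [R Ru [D _ BE]]] := int_Smith_normal_form B.
rewrite -/(diag_int D) in BE.
have D0 (j : 'I_s) : row j (diag_int D) <> 0.
  move=> Dj; have e0 : (delta_mx 0 j : 'rV_s) *m invmx L *m B = 0.
    by rewrite BE -!mulmxA mulKmx // mulmxA -rowE Dj mul0mx.
  have := congr1 (fun b : 'rV_s => b *m L) (Binj _ e0).
  by rewrite mulmxKV // mul0mx => /matrixP/(_ 0 j)/eqP; rewrite !mxE !eqxx.
have sd : (s <= d)%N.
  rewrite leqNgt; apply/negP => ds; apply: (D0 (Ordinal ds)).
  apply/rowP => i; rewrite !mxE /=; case: eqP => // di.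
  by have := ltn_ord i; rewrite -di ltnn.
have Dnz j : (j < s)%N -> D`_j != 0.
  move=> js; apply/eqP => Dj; apply: (D0 (Ordinal js)).
  by apply/rowP => i; rewrite !mxE /= Dj mul0rn.
pose E : 'M[k]_(d, s) := \matrix_(i, j) ((D`_j)%:~R^-1 *+ (i == j :> nat)).
have DE : map_mx intr (diag_int D) *m E = 1%:M.
  apply/matrixP => i j; rewrite !mxE (bigD1 (widen_ord sd i)) //= big1; last first.
    move=> l li; rewrite !mxE; case: (eqVneq (i : nat) l) => [il|]; last first.
      by rewrite mulr0n mul0r.
    by case/eqP: li; apply: val_inj.
  rewrite !mxE /= eqxx mulr1n addr0; have [->|ij] := eqVneq i j.
    by rewrite eqxx mulr1n divff // (pchar0_intr_eq0 char0) Dnz.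
  by rewrite (_ : (i == j :> nat) = false) ?mulr0n ?mulr0 //; apply: negPf.
pose Lk : 'M[k]_s := map_mx intr (invmx L).
pose Rk : 'M[k]_d := map_mx intr (invmx R).
exists (Rk *m (E *m (Lk *m v))); rewrite BE !map_mxM -!mulmxA.
rewrite (mulmxA _ Rk) -map_mxM mulmxV // map_mx1 mul1mx (mulmxA _ E) DE mul1mx.
by rewrite mulmxA -map_mxM mulmxV // map_mx1 mul1mx.
Qed.

End SmithConsequences.

(** The coordinates of the parametrization are regular characters, hence monomials; the rows of [A]
    are their exponents. *)
Lemma diagonal_torus_monomial (k : fieldType) n (G : {pred torus k n}) :
  diagonal_torus G ->
  exists d (A : 'M[int]_(n, d)),
    forall g, g \in G <-> exists t, g = torus_mx t A.
Proof.
case=> d [phi [[phiM phi_reg _] GE]]; exists d.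
have /choice[a aP] i : exists a, (fun t => phi t 0 i) = tpow^~ a.
  apply: regular_character_monomial (phi_reg i).
  split=> [s t|]; first by rewrite phiM torusM.
  by exists 1%g; apply: torus_neq0.
exists (\matrix_i a i) => g; split=> [/GE[t ->]|[t ->]]; last first.
  apply/GE; exists t; apply/val_inj/rowP => i; rewrite mxE rowK.
  by have /(congr1 (@^~ t)) := aP i.
exists t; apply/val_inj/rowP => i; rewrite mxE rowK.
by have /(congr1 (@^~ t)) := aP i.
Qed.

(** * Trivial characters and Lie algebras of G and H *)

Section LatticeFacts.
Variables (k : closedFieldType) (char0 : [pchar k] =i pred0).
Variables (r s : nat) (G : {pred torus k (r + s)}).
Hypotheses (hG : diagonal_torus G) (hW : transitive_W G).
Variable w : torus k s.
Let H := stab G w.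
Implicit Types (x : 'rV[k]_(r + s)) (g h : torus k (r + s)).

Lemma stabP g :
  reflect (g \in G /\ forall j, g 0 (rshift r j) = 1) (g \in H).
Proof.
apply: (iffP andP) => [[gG /eqP gw]|[gG gW]]; split=> //.
  move=> j; have := congr1 (fun t : torus k s => t 0 j) gw; rewrite torusM mxE.
  by move/(canRL (mulfK (torus_neq0 w j))); rewrite divff ?torus_neq0.
by apply/eqP/val_inj/rowP => j; rewrite torusM mxE gW mul1r.
Qed.

Lemma tpow_row_mx g (a : 'rV[int]_r) (b : 'rV[int]_s) :
  tpow g (row_mx a b) = tpow (torus_V g) a * tpow (torus_W g) b.
Proof.
rewrite /tpow big_split_ord /=; congr (_ * _); apply: eq_bigr => i _.
  by rewrite row_mxEl mxE.
by rewrite row_mxEr mxE.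
Qed.

(** The last clause is transitivity: [G] maps onto the torus of [W], so a nonzero exponent on [W]
    alone cannot be trivial on [G]. *)
Lemma torus_mx_group : exists d (A : 'M[int]_(r + s, d)),
  [/\ forall g, g \in G <-> exists t, g = torus_mx t A,
     forall a, trivial_on G a <-> a *m A = 0
   & forall b : 'rV_s, b *m dsubmx A = 0 -> b = 0].
Proof.
have [d [A GA]] := diagonal_torus_monomial hG; exists d, A.
have GT a : trivial_on G a <-> a *m A = 0.
  split=> [aG|aA g /GA[t ->]]; last by rewrite tpow_torus_mx aA tpow0.
  apply/rowP => j; rewrite [RHS]mxE; apply: (exp2z_eq1 char0).
  rewrite -tpow_point ?pchar0_two_neq0 // -tpow_torus_mx.
  by apply: aG; apply/GA; eexists.
split=> // b bA; have /GT bG : row_mx 0 b *m A = 0.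
  by rewrite -[A]vsubmxK mul_row_col mul0mx add0r.
apply/rowP => j; rewrite [RHS]mxE; apply: (exp2z_eq1 char0).
rewrite -tpow_point ?pchar0_two_neq0 //.
have [g gG gj] := hW 1%g (torus_point j 2%:R).
by have := bG g gG; rewrite tpow_row_mx tpow0 mul1r -gj mulg1.
Qed.

(** [H] is the image of the kernel of the monomial map of [dsubmx A]. The pullback of [a] is trivial
    on this kernel, hence an integral combination of the rows of [dsubmx A]; its negative gives
    [b]. *)
Lemma stab_trivial_lift (a : 'rV[int]_r) :
  trivial_on (image_V H) a -> exists b, trivial_on G (row_mx a b).
Proof.
move=> aH; have [d [A [GA GT _]]] := torus_mx_group.
have [|b bE] := @trivial_on_monomial_kernel k char0 s d (dsubmx A) (a *m usubmx A).
  move=> t tA; have tH : torus_mx t A \in H.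
    apply/stabP; split=> [|j]; first by apply/GA; eexists.
    by rewrite mxE -(tA j); congr tpow; apply/rowP => i; rewrite !mxE.
  have := aH (torus_V (torus_mx t A)); rewrite -tpow_torus_mx => <-.
    by congr tpow; apply/val_inj/rowP => i; rewrite !mxE; congr tpow;
      apply/rowP => j; rewrite !mxE.
  by apply/asboolP; exists (torus_mx t A).
exists (- b); apply/GT; rewrite -[A]vsubmxK mul_row_col bE mulNmx.
by rewrite subrr.
Qed.

Lemma trivial_on_W (b : 'rV[int]_s) : trivial_on G (row_mx 0 b) -> b = 0.
Proof.
move=> bG; have [d [A [_ GT Ainj]]] := torus_mx_group.
by apply: Ainj; move/GT: bG; rewrite -[A]vsubmxK mul_row_col mul0mx add0r col_mxKd.
Qed.

Lemma trivial_on_stab (a : 'rV[int]_r) (b : 'rV[int]_s) :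
  trivial_on G (row_mx a b) -> trivial_on (image_V H) a.
Proof.
move=> abG _ /asboolP[g /stabP[gG gW] ->].
have := abG g gG; rewrite tpow_row_mx [X in _ * X]big1 ?mulr1 // => j _.
by rewrite mxE gW exp1rz.
Qed.

Lemma torus_group_closed :
  (exists g, g \in G) /\ (forall g h, g \in G -> h \in G -> (g * h)%g \in G).
Proof.
have [d [A [GA _ _]]] := torus_mx_group; split.
  by exists (torus_mx 1%g A); apply/GA; eexists.
move=> _ _ /GA[t ->] /GA[u ->]; apply/GA; exists (t * u)%g.
by apply/val_inj/rowP => i; rewrite !mxE tpowM.
Qed.

Lemma lie_groupP x : (x \in lie_pred G) <->
  (forall a, trivial_on G a -> \sum_i (a 0 i)%:~R * x 0 i = 0).
Proof. by have [Gn GM] := torus_group_closed; exact: lie_predP. Qed.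

Lemma lie_trivial x a b : x \in lie_pred G -> trivial_on G (row_mx a b) ->
  \sum_i (a 0 i)%:~R * x 0 (lshift s i) =
  - \sum_j (b 0 j)%:~R * x 0 (rshift r j).
Proof.
move=> /lie_groupP xG /xG; rewrite big_split_ord /= => /eqP.
rewrite addr_eq0 => /eqP h.
under eq_bigr => i _ do rewrite -(row_mxEl a b).
by rewrite h; congr (- _); apply: eq_bigr => i _; rewrite row_mxEr.
Qed.

(** The differential of the parametrization has image in Lie(G), and its W-part [dsubmx A] is onto
    over [k]. *)
Lemma lie_lift_W (v : 'rV[k]_s) : exists x : lie G, rsubmx x = v.
Proof.
have [d [A [_ GT Ainj]]] := torus_mx_group.
have [y yE] := intr_mulmx_surjective char0 v^T Ainj.
have xG : (map_mx intr A *m y)^T \in lie_pred G.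
  apply/lie_groupP => a /GT aA.
  transitivity ((map_mx intr a *m (map_mx intr A *m y)) 0 0).
    by rewrite mxE; apply: eq_bigr => i _; rewrite !mxE.
  by rewrite mulmxA -map_mxM aA map_mx0 mul0mx mxE.
exists (Lie xG); apply/rowP => j /=; rewrite !mxE.
have /matrixP/(_ j 0) := yE; rewrite !mxE => <-.
by apply: eq_bigr => i _; rewrite !mxE.
Qed.

(** For the converse, a character trivial on [H] has a V-part with a companion trivial on [G]; as
    [x] has no W-part, its pairing with [x] sees only the V-part. *)
Lemma lie_stabP (x : 'rV[k]_(r + s)) :
  x \in lie_pred H <-> x \in lie_pred G /\ rsubmx x = 0.
Proof.
have [[g0 g0G] GM] := torus_group_closed.
have H1 : exists g, g \in H.
  have [g gG gE] := hW w w; exists g.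
  by apply/andP; split=> //; apply/eqP.
have HM g h : g \in H -> h \in H -> (g * h)%g \in H.
  move=> /stabP[gG gW] /stabP[kG kW]; apply/stabP; split=> [|j].
    exact: GM.
  by rewrite torusM gW kW mulr1.
have HP := lie_predP x H1 HM; split=> [xH|[xG xW]].
  split; first exact: (valP (lie_incl (@stab_sub k r s G w) (Lie xH))).
  apply/rowP => j; rewrite !mxE.
  have [/(_ xH) xH' _] := HP; rewrite -[RHS](xH' (delta_mx 0 (rshift r j))).
    rewrite (bigD1 (rshift r j)) //= big1 => [|i /negPf ij].
      by rewrite mxE !eqxx mul1r addr0.
    by rewrite mxE ij mul0r.
  by move=> g /stabP[_ gW]; rewrite tpow_delta gW.
apply/HP => a aH.
have aE : a = row_mx (lsubmx a) (rsubmx a) by rewrite hsubmxK.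
have /stab_trivial_lift[b abG] : trivial_on (image_V H) (lsubmx a).
  move=> _ /asboolP[g gH ->]; have := aH g gH; rewrite {1}aE tpow_row_mx.
  rewrite [X in _ * X]big1 ?mulr1 // => j _.
  by have /stabP[_ gW] := gH; rewrite mxE gW exp1rz.
have xW0 j : x 0 (rshift r j) = 0.
  by have /rowP/(_ j) := xW; rewrite !mxE.
rewrite big_split_ord /= [X in _ + X]big1 => [|j _]; last by rewrite xW0 mulr0.
rewrite addr0; have := lie_trivial xG abG; rewrite [X in - X]big1 => [|j _].
  by rewrite oppr0 => h; rewrite -[RHS]h; apply: eq_bigr => i _; rewrite mxE.
by rewrite xW0 mulr0.
Qed.

End LatticeFacts.

(** * Polynomial functions and graded operators *)

(* Imported only now, because it hides the mcoeff of mpoly.                   *)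
From mathcomp.multinomials Require monalg.
Import -(notations) monalg.

Section PolynomialFunctions.
Variables (k : fieldType) (s : nat).
Implicit Types (q : 'rV[k]_s -> k) (x y : 'rV[k]_s).

Inductive polyfun : ('rV[k]_s -> k) -> Prop :=
| polyfun_const c : polyfun (fun=> c)
| polyfun_coord j : polyfun (fun x => x 0 j)
| polyfunD f g : polyfun f -> polyfun g -> polyfun (fun x => f x + g x)
| polyfunM f g : polyfun f -> polyfun g -> polyfun (fun x => f x * g x).

Lemma polyfun_shift q y : polyfun q -> polyfun (fun x => q (x + y)).
Proof.
elim=> [c|j|f g _ IHf _ IHg|f g _ IHf _ IHg]; first exact: polyfun_const.
- rewrite (_ : (fun x => _) = (fun x : 'rV_s => x 0 j + y 0 j)); last first.
    by apply/funext => x; rewrite mxE.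
  by apply: polyfunD; [exact: polyfun_coord | exact: polyfun_const].
- exact: polyfunD.
- exact: polyfunM.
Qed.

Lemma polyfun_sum (I : Type) (l : seq I) (f : I -> 'rV[k]_s -> k) :
  (forall i, polyfun (f i)) -> polyfun (fun x => \sum_(i <- l) f i x).
Proof.
move=> pf; elim: l => [|i l IH].
  rewrite (_ : (fun x => _) = fun=> 0); first exact: polyfun_const.
  by apply/funext => x; rewrite big_nil.
rewrite (_ : (fun x => _) = fun x => f i x + \sum_(j <- l) f j x).
  exact: polyfunD.
by apply/funext => x; rewrite big_cons.
Qed.

Lemma polyfun_line q x (j : 'I_s) : polyfun q ->
  exists p : {poly k}, forall t,
    q (\row_i (if i == j then t else x 0 i)) = p.[t].
Proof.
elim=> [c|i|f g _ [p hp] _ [p' hp']|f g _ [p hp] _ [p' hp']].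
- by exists c%:P => t; rewrite hornerC.
- have [->|/negPf ij] := eqVneq i j.
    by exists 'X => t; rewrite hornerX mxE eqxx.
  by exists (x 0 i)%:P => t; rewrite hornerC mxE ij.
- by exists (p + p') => t; rewrite hornerD hp hp'.
- by exists (p * p') => t; rewrite hornerM hp hp'.
Qed.

End PolynomialFunctions.

Section PolynomialFunctionsChar0.
Variables (k : closedFieldType) (char0 : [pchar k] =i pred0) (s : nat).

Lemma poly_nat_roots (p : {poly k}) : (forall m : nat, p.[m%:R] = 0) -> p = 0.
Proof.
move=> hp; apply: (@roots_geq_poly_eq0 _ p [seq m%:R | m <- iota 0 (size p)]).
- by apply/allP => _ /mapP[m _ ->]; apply/rootP.
- rewrite map_inj_uniq ?iota_uniq // => m m' mm'.
  by have [] : m%:Z = m'%:Z by apply: (pchar0_intr_inj char0).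
- by rewrite size_map size_iota.
Qed.

(** Coordinates are freed from integrality one at a time: a one-variable polynomial vanishing at all
    natural numbers is 0 in characteristic 0. *)
Lemma polyfun_eq0 (q : 'rV[k]_s -> k) : polyfun q ->
  (forall v : 'rV[int]_s, q (map_mx intr v) = 0) -> forall x, q x = 0.
Proof.
move=> qP q0.
suff main m (x : 'rV[k]_s) :
    (forall i : 'I_s, (m <= i)%N -> exists z : int, x 0 i = z%:~R) ->
    q x = 0.
  by move=> x; apply: (main s) => i; rewrite leqNgt ltn_ord.
elim: m x => [|m IH] x xP.
  have /choice[z zP] i := xP i isT.
  by rewrite -(q0 (\row_i z i)); congr q; apply/rowP => i; rewrite !mxE zP.
have [sm|ms] := leqP s m.
  by apply: IH => i mi; move: (ltn_ord i); rewrite ltnNge (leq_trans sm mi).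
pose j := Ordinal ms; have [p hp] := polyfun_line x j qP.
have p0 : p = 0.
  apply: poly_nat_roots => l; rewrite -hp; apply: IH => i mi; rewrite mxE.
  have [_|ij] := eqVneq i j; first by exists l%:Z.
  by apply: xP; rewrite ltn_neqAle mi eq_sym ij.
have := hp (x 0 j); rewrite p0 horner0 => <-; congr q.
by apply/rowP => i; rewrite mxE; case: eqP => [->|].
Qed.

End PolynomialFunctionsChar0.

Lemma natrb_neq0 (R : nzRingType) (b : bool) : (b%:R != 0 :> R) = b.
Proof. by case: b; rewrite ?oner_neq0 ?eqxx. Qed.

HB.lock Definition cf (k : fieldType) (n : nat) (u : pred 'I_n)
    (D : endo k u) (e e' : expo u) : k := mcoeff e' (D (mono_expo e)).
Arguments cf {k n u}.

(** * Matrix coefficients and weights of operators *)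

Section MatrixCoefficients.
Variables (k : fieldType) (n : nat) (u : pred 'I_n).
Local Notation endo := (endo k u).
Local Notation expo := (expo u).
Implicit Types (D E : endo) (e : expo) (p : coordring k u).

Lemma mcoeff_mono_expo e e' :
  mcoeff e' (mono_expo e : coordring k u) = (e == e')%:R.
Proof. by rewrite mcoeffU. Qed.

Lemma mkmalgU_mono_expo e a : mkmalgU e a = a *: mono_expo e :> coordring k u.
Proof.
by apply/malgP => e'; rewrite mcoeffZ [LHS]mcoeffU mcoeff_mono_expo mulr_natr.
Qed.

Lemma coordring_ind (P : coordring k u -> Prop) :
  P 0 -> (forall e, P (mono_expo e)) ->
  (forall a p q, P p -> P q -> P (a *: p + q)) -> forall p, P p.
Proof.
move=> P0 PU Plin p; rewrite [p]monalgE; apply: (big_ind P) => // [x y Px Py|e _].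
  by rewrite -[x]scale1r; apply: Plin.
by rewrite mkmalgU_mono_expo -[X in P X]addr0; apply: Plin.
Qed.

Lemma mcoeff_lin e a p q :
  mcoeff e (a *: p + q : coordring k u) = a * mcoeff e p + mcoeff e q.
Proof. by rewrite mcoeffD mcoeffZ. Qed.

Lemma mcoeff_mono (a : 'rV[int]_n) e :
  mcoeff e (mono a : coordring k u) = (a == expo_val e)%:R.
Proof.
rewrite /mono; case: insubP => [e' _ <-|]; first by rewrite mcoeff_mono_expo.
by rewrite mcoeff0; case: eqP => // ->; rewrite (expoP e).
Qed.

Lemma cfE D e e' : cf D e e' = mcoeff e' (D (mono_expo e)).
Proof. by rewrite cf.unlock. Qed.

Lemma cfP D E : (forall e e', cf D e e' = cf E e e') -> D = E.
Proof.
by move=> h; apply: endo_mono_ext => e; apply/malgP => e'; rewrite -!cfE.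
Qed.

Lemma cf0 e e' : cf (0 : endo) e e' = 0. Proof. by rewrite cfE mcoeff0. Qed.
Lemma cfD D E e e' : cf (D + E) e e' = cf D e e' + cf E e e'.
Proof. by rewrite !cfE endoD mcoeffD. Qed.
Lemma cfZ a D e e' : cf (a *: D) e e' = a * cf D e e'.
Proof. by rewrite !cfE endoZ mcoeffZ. Qed.
Lemma cf1 e e' : cf (1 : endo) e e' = (e == e')%:R.
Proof. by rewrite cfE endoE1 mcoeff_mono_expo. Qed.
Lemma cf_sum I (r : seq I) (P : pred I) (F : I -> endo) e e' :
  cf (\sum_(i <- r | P i) F i) e e' = \sum_(i <- r | P i) cf (F i) e e'.
Proof. by apply: (big_morph (fun D => cf D e e')) => [D E|]; rewrite ?cfD ?cf0. Qed.

Lemma cf_opQ i e e' :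
  cf (opQ k u i) e e' = (expo_val e + delta_mx 0 i == expo_val e')%:R.
Proof. by rewrite cfE opQ_mono_expo mcoeff_mono. Qed.
Lemma cf_opQV i e e' :
  cf (opQV k u i) e e' = (expo_val e - delta_mx 0 i == expo_val e')%:R.
Proof. by rewrite cfE opQV_mono_expo mcoeff_mono. Qed.
Lemma cf_opP i e e' :
  cf (opP k u i) e e' =
  (e 0 i)%:~R * (expo_val e - delta_mx 0 i == expo_val e')%:R.
Proof. by rewrite cfE opP_mono_expo mcoeffZ mcoeff_mono. Qed.

Lemma mcoeff_act (g : torus k n) p e :
  mcoeff e (act u g p) = tpow g e * mcoeff e p.
Proof.
move: p; apply: coordring_ind => [|e'|a p q IHp IHq].
- by rewrite linear0 mcoeff0 mulr0.
- rewrite act_mono_expo mcoeffZ mcoeff_mono_expo.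
  by case: eqP => [->|]; rewrite ?mulr0.
- by rewrite linearP !mcoeff_lin IHp IHq mulrDr mulrCA.
Qed.

Lemma cf_diffop_act g D e e' :
  cf (diffop_act g D) e e' = tpow g (expo_val e' - expo_val e) * cf D e e'.
Proof.
rewrite !cfE /diffop_act !endoM act_mono_expo !linearZ /= mcoeffZ mcoeff_act.
rewrite tpowD tpowN mulrCA mulrA; congr (_ * _ * _).
rewrite -prodfV; apply: eq_bigr => i _.
by rewrite torusV exprz_inv invr_expz.
Qed.

Lemma cf_mul_neq0 D E e e' : cf (D * E) e e' != 0 ->
  exists e1, cf E e e1 != 0 /\ cf D e1 e' != 0.
Proof.
move=> nz; apply: contrapT => /forallNP h; move/eqP: nz; apply.
suff : forall p, (forall e1, mcoeff e1 p = 0 \/ cf D e1 e' = 0) ->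
    mcoeff e' (D p) = 0.
  move=> hp; rewrite cfE endoM; apply: hp => e1; rewrite -cfE.
  have [E0|nE] := eqVneq (cf E e e1) 0; first by left.
  have [D0|nD] := eqVneq (cf D e1 e') 0; first by right.
  by case: (h e1).
move=> p hp; rewrite [p]monalgE linear_sum raddf_sum big1 // => e1 _.
by rewrite mkmalgU_mono_expo linearZ /= mcoeffZ -cfE;
  have [->|/= ->] := hp e1; rewrite ?mul0r ?mulr0.
Qed.

Definition weight D (d : 'rV[int]_n) : Prop :=
  forall e e', cf D e e' != 0 -> expo_val e' = expo_val e + d.

Lemma weight_cf D d e e' :
  weight D d -> expo_val e' != expo_val e + d -> cf D e e' = 0.
Proof. by move=> wD; apply: contraNeq => /wD ->. Qed.

Lemma weightM D E d d' : weight D d -> weight E d' -> weight (D * E) (d + d').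
Proof.
move=> wD wE e e' /cf_mul_neq0[e1 [/wE e1E /wD ->]].
by rewrite e1E addrAC addrA.
Qed.

Lemma diffop0 : diffop (0 : endo).
Proof.
rewrite -(addNr 1) -scaleN1r; apply: diffop_lin; exact: diffop_1.
Qed.

Lemma diffopD D E : diffop D -> diffop E -> diffop (D + E).
Proof. by rewrite -{2}[D]scale1r => dD dE; apply: diffop_lin. Qed.

Lemma diffopZ a D : diffop D -> diffop (a *: D).
Proof. by rewrite -[_ *: D]addr0 => dD; apply: diffop_lin => //; exact: diffop0. Qed.

Lemma weight1 : weight 1 0.
Proof.
by move=> e e'; rewrite cf1 addr0 natrb_neq0 => /eqP->.
Qed.

Lemma weightZ a D d : weight D d -> weight (a *: D) d.
Proof. by move=> wD e e'; rewrite cfZ mulf_eq0 negb_or => /andP[_ /wD]. Qed.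

Lemma weight_opQ i : weight (opQ k u i) (delta_mx 0 i).
Proof. by move=> e e'; rewrite cf_opQ natrb_neq0 => /eqP<-. Qed.
Lemma weight_opQV i : weight (opQV k u i) (- delta_mx 0 i).
Proof. by move=> e e'; rewrite cf_opQV natrb_neq0 => /eqP<-. Qed.
Lemma weight_opP i : weight (opP k u i) (- delta_mx 0 i).
Proof.
by move=> e e'; rewrite cf_opP mulf_eq0 negb_or natrb_neq0 => /andP[_ /eqP<-].
Qed.

(** Only the existence of a homogeneous decomposition is recorded; comparison of matrix coefficients
    replaces uniqueness. *)
Inductive homog_sum (P : 'rV[int]_n -> Prop) : endo -> Prop :=
| homog_sum_in D d : P d -> diffop D -> weight D d -> homog_sum P D
| homog_sum0 : homog_sum P 0
| homog_sumD D E : homog_sum P D -> homog_sum P E -> homog_sum P (D + E).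

Lemma homog_sumZ P a D : homog_sum P D -> homog_sum P (a *: D).
Proof.
elim=> [{}D d Pd dD wD||{}D E _ IHD _ IHE].
- exact: (homog_sum_in Pd (diffopZ _ dD) (weightZ wD)).
- by rewrite scaler0; exact: homog_sum0.
- by rewrite scalerDr; exact: homog_sumD.
Qed.

Lemma diffop_homog_sum D : diffop D -> homog_sum (fun=> True) D.
Proof.
elim=> [i|i ui|i||a {}D E _ hD _ hE|{}D E _ hD _ hE].
- by apply: (homog_sum_in _ _ (@weight_opQ i)) => //; constructor.
- by apply: (homog_sum_in _ _ (@weight_opQV i)) => //; constructor.
- by apply: (homog_sum_in _ _ (@weight_opP i)) => //; constructor.
- by apply: (homog_sum_in _ _ weight1) => //; constructor.
- by apply: homog_sumD => //; exact: homog_sumZ.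
elim: hD => [{}D d _ dD wD||{}D D' _ IHD _ IHD'].
- elim: hE => [{}E d' _ dE wE||{}E E' _ IHE _ IHE'].
  + by apply: (homog_sum_in _ _ (weightM wD wE)) => //; exact: diffop_mul.
  + by rewrite mulr0; exact: homog_sum0.
  + by rewrite mulrDr; exact: homog_sumD.
- by rewrite mul0r; exact: homog_sum0.
- by rewrite mulrDl; exact: homog_sumD.
Qed.

Lemma homog_sum_filter (P : 'rV[int]_n -> Prop) D : homog_sum (fun=> True) D ->
  exists2 D', homog_sum P D' &
  forall e e', cf D' e e' =
    if `[< P (expo_val e' - expo_val e) >] then cf D e e' else 0.
Proof.
elim=> [{}D d _ dD wD||{}D E _ [D' PD hD] _ [E' PE hE]].
- have [Pd|Pd] := pselect (P d).
    exists D => [|e e']; first exact: (homog_sum_in _ _ wD).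
    case: asboolP => // nP; apply: (weight_cf wD); apply/eqP => eE.
    by apply: nP; rewrite eE addrC addKr.
  exists 0 => [|e e']; first exact: homog_sum0.
  rewrite cf0; case: asboolP => // Pe; rewrite (weight_cf wD) //.
  by apply/eqP => eE; apply: Pd; move: Pe; rewrite eE addrC addKr.
- by exists 0 => [|e e']; [exact: homog_sum0 | rewrite cf0; case: ifP].
- exists (D' + E') => [|e e']; first exact: homog_sumD.
  by rewrite !cfD hD hE; case: ifP; rewrite ?addr0.
Qed.

(** An element [g] scales the entry from [e] to [e'] by the character [e' - e], so invariance kills
    the entries of nontrivial character and discarding the other weights changes nothing. *)
Lemma diffop_inv_homog_sum (K : {pred torus k n}) D :
  D \in @inv_pred k n u K -> homog_sum (trivial_on K) D.
Proof.
move=> /asboolP[/diffop_homog_sum /(homog_sum_filter (trivial_on K))[D' PD' hD'] iD].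
suff -> : D = D' by [].
apply: cfP => e e'; rewrite hD'; case: asboolP => // /existsNP[g /not_implyP[gK gE]].
apply/eqP; have := cf_diffop_act g D e e'; rewrite iD // => /eqP.
rewrite -subr_eq0 -{1}[cf D e e']mul1r -mulrBl mulf_eq0 subr_eq0.
by case/orP=> // /eqP/esym/gE.
Qed.

Lemma cf_inv_trivial (K : {pred torus k n}) D e e' :
  D \in @inv_pred k n u K -> cf D e e' != 0 ->
  trivial_on K (expo_val e' - expo_val e).
Proof.
move=> /asboolP[_ iD] nz g gK; apply: (mulIf nz).
by rewrite -cf_diffop_act iD // mul1r.
Qed.

Lemma inv_predP (K : {pred torus k n}) D : diffop D ->
  (forall e e', cf D e e' != 0 -> trivial_on K (expo_val e' - expo_val e)) ->
  D \in @inv_pred k n u K.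
Proof.
move=> dD hD; apply/asboolP; split=> // g gK; apply: cfP => e e'.
rewrite cf_diffop_act; have [->|/hD ->] := eqVneq (cf D e e') 0 => //.
  by rewrite mulr0.
by rewrite mul1r.
Qed.

Lemma weight_inv (K : {pred torus k n}) D d :
  diffop D -> weight D d -> trivial_on K d -> D \in @inv_pred k n u K.
Proof.
move=> dD wD dK; apply: inv_predP => // e e' /wD ->.
by rewrite addrC addKr.
Qed.

End MatrixCoefficients.

(** * Operators on the product *)

Section LinearExtension.
Variables (k : fieldType) (n : nat) (u : pred 'I_n) (U : lmodType k).
Implicit Types (h : expo u -> U) (p : coordring k u).

(** Unlike [linext], the target is any module; [twist] needs maps from O(V) to O(Y). *)
Definition lext h p : U := \sum_(e <- msupp p) mcoeff e p *: h e.

Lemma lextEw h p (d : {fset expo u}) :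
  (msupp p `<=` d)%fset -> lext h p = \sum_(e <- d) mcoeff e p *: h e.
Proof.
move=> le; rewrite /lext (big_fset_incl _ le) //= => e _ /mcoeff_outdom ->.
by rewrite scale0r.
Qed.

Fact lext_linear h : linear (lext h).
Proof.
move=> a p q; pose d := (msupp p `|` msupp q)%fset.
rewrite !(@lextEw h _ d) ?fsubsetUl ?fsubsetUr //; last first.
  by apply: fsubset_trans (msuppD_le _ _) _; apply/fsetSU/msuppZ_le.
rewrite scaler_sumr -big_split; apply: eq_bigr => e _ /=.
by rewrite mcoeffD mcoeffZ scalerDl scalerA.
Qed.

HB.instance Definition _ h :=
  GRing.isLinear.Build k (coordring k u) U _ (lext h) (lext_linear h).

Lemma lextU h e : lext h (mono_expo e) = h e.
Proof.
rewrite (lextEw _ msuppU_le) big_seq_fset1 mcoeffUU.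
by rewrite scale1r.
Qed.

Lemma lext_ext h h' p : (forall e, mcoeff e p != 0 -> h e = h' e) ->
  lext h p = lext h' p.
Proof.
move=> hh'; apply: eq_bigr => e _.
by have [->|/hh' ->] := eqVneq (mcoeff e p) 0; rewrite ?scale0r.
Qed.

Lemma lextZ a h p : lext (fun e => a *: h e) p = a *: lext h p.
Proof. by rewrite scaler_sumr; apply: eq_bigr => e _; rewrite !scalerA mulrC. Qed.

Lemma lext_endo h (D : endo k u) p :
  lext h (D p) = lext (fun e => lext h (D (mono_expo e))) p.
Proof.
move: p; apply: coordring_ind => [|e|a p q IHp IHq].
- by rewrite !linear0.
- by rewrite lextU.
- rewrite [RHS]linearP [D _]linearP [LHS]linearP.
  exact: (congr2 (fun x y => a *: x + y) IHp IHq).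
Qed.

End LinearExtension.

Lemma linear_lext (k : fieldType) n (u : pred 'I_n) (U U' : lmodType k)
    (F : {linear U -> U'}) (h : expo u -> U) (p : coordring k u) :
  F (lext h p) = lext (F \o h) p.
Proof. by rewrite linear_sum; apply: eq_bigr => e _; rewrite linearZ. Qed.

Section ProductExponents.
Variables (r s : nat).

Lemma eq_row_mxE (R : eqType) (a a' : 'rV[R]_r) (b b' : 'rV[R]_s) :
  (row_mx a b == row_mx a' b') = (a == a') && (b == b').
Proof.
by apply/eqP/andP => [/eq_row_mx[-> ->]|[/eqP-> /eqP->]].
Qed.

Lemma delta_mx_lshift (R : pzRingType) i :
  delta_mx 0 (lshift s i) = row_mx (delta_mx 0 i) 0 :> 'rV[R]_(r + s).
Proof.
apply/rowP => j; case: (split_ordP j) => l ->; rewrite ?(row_mxEl, row_mxEr) !mxE /=.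
  by rewrite (inj_eq (@lshift_inj _ _)).
by rewrite eq_rlshift.
Qed.

Lemma delta_mx_rshift (R : pzRingType) j :
  delta_mx 0 (rshift r j) = row_mx 0 (delta_mx 0 j) :> 'rV[R]_(r + s).
Proof.
apply/rowP => i; case: (split_ordP i) => l ->; rewrite ?(row_mxEl, row_mxEr) !mxE /=.
  by rewrite eq_lrshift.
by rewrite (inj_eq (@rshift_inj _ _)).
Qed.

Fact expo_pair_subproof (e : expo (@unitsV r)) (v : 'rV[int]_s) :
  [forall i, @unitsY r s i || (0 <= (row_mx e v) 0 i)].
Proof.
apply/forallP => i; case: (split_ordP i) => j ->; last first.
  by rewrite /unitsY leq_addr.
by rewrite row_mxEl; have /forallP/(_ j)/= -> := expoP e; rewrite orbT.
Qed.
Definition expo_pair e v := Expo (expo_pair_subproof e v).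

Fact expo_V_subproof (E : expo (@unitsY r s)) :
  [forall i, @unitsV r i || (0 <= (lsubmx (E : 'rV_(r + s))) 0 i)].
Proof.
apply/forallP => i; rewrite mxE; have /forallP/(_ (lshift s i)) := expoP E.
by rewrite /unitsY /= leqNgt ltn_ord.
Qed.
Definition expo_V E := Expo (expo_V_subproof E).
Definition expo_W (E : expo (@unitsY r s)) : 'rV[int]_s :=
  rsubmx (E : 'rV_(r + s)).

Lemma expo_pairE e v : expo_val (expo_pair e v) = row_mx (expo_val e) v.
Proof. by []. Qed.
Lemma expo_pair_eta E : E = expo_pair (expo_V E) (expo_W E).
Proof. by apply: val_inj => /=; rewrite hsubmxK. Qed.
Lemma expo_VK e v : expo_V (expo_pair e v) = e.
Proof. by apply: val_inj; rewrite /= row_mxKl. Qed.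
Lemma expo_WK e v : expo_W (expo_pair e v) = v.
Proof. by rewrite /expo_W /= row_mxKr. Qed.

Lemma expo_pair_eq e v e' v' :
  (expo_pair e v == expo_pair e' v') = (e == e') && (v == v').
Proof. by rewrite -val_eqE /= eq_row_mxE. Qed.

End ProductExponents.

Definition mono_shift (k : fieldType) (r s : nat)
    (b : 'rV[int]_r -> 'rV[int]_s) (e : expo (@unitsV r)) (v : 'rV[int]_s)
    (e' : expo (@unitsV r)) : coordring k (@unitsY r s) :=
  mono_expo (expo_pair e' (v + b (expo_val e' - expo_val e))).
Arguments mono_shift {k r s}.

(* The operator Q_V^e Q_W^v |-> q(v) D(Q_V^e) Q_W^v, in which the component   *)
(* of weight a of D is moreover multiplied by Q_W^(b a).                      *)
HB.lock Definition twist (k : fieldType) (r s : nat) (D : endo k (@unitsV r))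
    (b : 'rV[int]_r -> 'rV[int]_s) (q : 'rV[k]_s -> k) : endo k (@unitsY r s) :=
  Endo (linext (fun E => q (map_mx intr (expo_W E)) *:
    lext (mono_shift b (expo_V E) (expo_W E)) (D (mono_expo (expo_V E))))).
Arguments twist {k r s}.

Section Twist.
Variables (k : fieldType) (r s : nat).
Local Notation uV := (@unitsV r).
Local Notation uY := (@unitsY r s).
Implicit Types (D : endo k uV) (b : 'rV[int]_r -> 'rV[int]_s)
  (q : 'rV[k]_s -> k) (e : expo uV) (v : 'rV[int]_s).

Lemma twist_mono D b q e v : twist D b q (mono_expo (expo_pair e v)) =
  q (map_mx intr v) *: lext (mono_shift b e v) (D (mono_expo e)).
Proof. by rewrite twist.unlock [LHS]linextU expo_VK expo_WK. Qed.

Lemma cf_twist D b q e v e' v' :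
  cf (twist D b q) (expo_pair e v) (expo_pair e' v') =
  q (map_mx intr v) * cf D e e' * (v' == v + b (expo_val e' - expo_val e))%:R.
Proof.
rewrite cfE [cf D _ _]cfE twist_mono mcoeffZ -mulrA; congr (_ * _).
move: (D _); apply: coordring_ind => [|e1|a p p' IHp IHp'].
- by rewrite linear0 !mcoeff0 mul0r.
- rewrite lextU !mcoeff_mono_expo expo_pair_eq [v' == _]eq_sym.
  by have [->|] := eqVneq e1 e'; rewrite /= ?mul1r ?mul0r.
rewrite linearP [LHS]mcoeff_lin mcoeff_lin mulrDl -mulrA.
exact: (congr2 (fun x y => a * x + y) IHp IHp').
Qed.

Lemma twistP (F : endo k uY) D b q :
  (forall e v e' v', cf F (expo_pair e v) (expo_pair e' v') =
     q (map_mx intr v) * cf D e e' * (v' == v + b (expo_val e' - expo_val e))%:R) ->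
  F = twist D b q.
Proof.
move=> FE; apply: cfP => e e'.
by rewrite (expo_pair_eta e) (expo_pair_eta e') FE cf_twist.
Qed.

Lemma twist_linear b q : linear (fun D => twist D b q).
Proof.
move=> a D D'; apply/esym/twistP => e v e' v'.
by rewrite !(cfD, cfZ) !cf_twist mulrDr mulrDl -!mulrA [a * _]mulrCA.
Qed.

(** [D'] acts first and moves [v] by [b'], which translates the argument of [q]. The conditions are
    imposed only along nonzero entries because [shift_W] is additive only on characters trivial on
    [H]. *)
Lemma twistM D b q D' b' q' b'' q'' :
  (forall e e' e'', cf D' e e' != 0 -> cf D e' e'' != 0 ->
     b'' (expo_val e'' - expo_val e) =
     b' (expo_val e' - expo_val e) + b (expo_val e'' - expo_val e')) ->
  (forall v e e', cf D' e e' != 0 -> q'' (map_mx intr v) =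
     q' (map_mx intr v) *
     q (map_mx intr (v + b' (expo_val e' - expo_val e)))) ->
  twist D b q * twist D' b' q' = twist (D * D') b'' q''.
Proof.
move=> hb hq; apply: endo_mono_ext => E; rewrite (expo_pair_eta E).
move: (expo_V E) (expo_W E) => e v; rewrite endoM !twist_mono linearZ /=.
rewrite linear_lext [lext _ (D _)]lext_endo -!lextZ; apply: lext_ext => e' ne' /=.
rewrite -cfE in ne'; rewrite /mono_shift twist_mono scalerA.
rewrite (hq v e e' ne').
apply: congr1.
apply: lext_ext => e''.
rewrite -cfE => ne''.
by rewrite /mono_shift (hb _ _ _ ne' ne'') addrA.
Qed.

Lemma twist_weight D b q d : weight D d -> twist D b q = twist D (fun=> b d) q.
Proof.
move=> wD; apply: twistP => e v e' v'; rewrite cf_twist.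
have [->|/wD ->] := eqVneq (cf D e e') 0; first by rewrite mulr0 !mul0r.
by rewrite [_ + d - _]addrAC subrr add0r.
Qed.

Lemma twist_const D (c : k) v :
  twist D (fun=> v) (fun=> c) = c *: twist D (fun=> v) (fun=> 1).
Proof.
apply/esym/twistP => e v0 e' v'.
by rewrite cfZ cf_twist mul1r mulrA.
Qed.

Lemma twist_opQ i :
  twist (opQ k uV i) (fun=> 0) (fun=> 1) = opQ k uY (lshift s i).
Proof.
apply/esym/twistP => e v e' v'; rewrite !cf_opQ mul1r delta_mx_lshift /=.
by rewrite add_row_mx eq_row_mxE -mulnb natrM [v' == _]eq_sym.
Qed.

Lemma twist_opP i :
  twist (opP k uV i) (fun=> 0) (fun=> 1) = opP k uY (lshift s i).
Proof.
apply/esym/twistP => e v e' v'; rewrite !cf_opP mul1r delta_mx_lshift /=.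
rewrite opp_row_mx add_row_mx eq_row_mxE -mulnb natrM row_mxEl oppr0.
by rewrite [v' == _]eq_sym mulrA.
Qed.

Lemma twist1 : twist 1 (fun=> 0) (fun=> 1) = 1 :> endo k uY.
Proof.
apply/esym/twistP => e v e' v'.
by rewrite !cf1 expo_pair_eq mul1r addr0 -mulnb natrM [v' == _]eq_sym.
Qed.

Lemma twist_opQ_W j :
  twist 1 (fun=> delta_mx 0 j) (fun=> 1) = opQ k uY (rshift r j).
Proof.
apply/esym/twistP => e v e' v'; rewrite cf1 cf_opQ mul1r delta_mx_rshift /=.
by rewrite add_row_mx eq_row_mxE -mulnb natrM [v' == _]eq_sym addr0.
Qed.

Lemma twist_opQV_W j :
  twist 1 (fun=> - delta_mx 0 j) (fun=> 1) = opQV k uY (rshift r j).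
Proof.
apply/esym/twistP => e v e' v'; rewrite cf1 cf_opQV mul1r delta_mx_rshift /=.
rewrite opp_row_mx add_row_mx eq_row_mxE -mulnb natrM [v' == _]eq_sym.
by rewrite oppr0 addr0.
Qed.

Lemma twist_opP_W j :
  twist 1 (fun=> - delta_mx 0 j) (fun x => x 0 j) = opP k uY (rshift r j).
Proof.
apply/esym/twistP => e v e' v'; rewrite cf1 cf_opP delta_mx_rshift /=.
rewrite opp_row_mx add_row_mx eq_row_mxE -mulnb natrM [v' == _]eq_sym.
by rewrite oppr0 addr0 row_mxEr mxE mulrA.
Qed.

Lemma twist_euler_W j :
  twist 1 (fun=> 0) (fun x => x 0 j) =
  opQ k uY (rshift r j) * opP k uY (rshift r j).
Proof.
rewrite -twist_opQ_W -twist_opP_W; apply/esym; rewrite -[in RHS](mulr1 1).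
apply: twistM => [*|*]; last by rewrite mulr1.
by rewrite addNr.
Qed.

Lemma twistM_const D v q D' v' q' :
  twist D (fun=> v) q * twist D' (fun=> v') q' =
  twist (D * D') (fun=> v + v') (fun x => q' x * q (x + map_mx intr v')).
Proof.
apply: twistM => [*|w *]; first by rewrite addrC.
by rewrite map_mxD.
Qed.

Lemma diffop_twistV D :
  diffop D -> diffop (twist D (fun=> 0) (fun=> 1) : endo k uY).
Proof.
elim=> [i|i //|i||a {}D E _ dD _ dE|{}D E _ dD _ dE].
- by rewrite twist_opQ; constructor.
- by rewrite twist_opP; constructor.
- by rewrite twist1; constructor.
- by rewrite (twist_linear (fun=> 0) (fun=> 1)); apply: diffop_lin.
rewrite (_ : twist _ _ _ =
  twist D (fun=> 0) (fun=> 1) * twist E (fun=> 0) (fun=> 1)).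
  exact: diffop_mul.
by rewrite twistM_const addr0 mulr1.
Qed.

Lemma diffop_twistW v : diffop (twist 1 (fun=> v) (fun=> 1) : endo k uY).
Proof.
have tD v1 v2 : diffop (twist 1 (fun=> v1) (fun=> 1) : endo k uY) ->
    diffop (twist 1 (fun=> v2) (fun=> 1) : endo k uY) ->
    diffop (twist 1 (fun=> v1 + v2) (fun=> 1) : endo k uY).
  by move=> d1 d2; have := diffop_mul d1 d2; rewrite twistM_const !mulr1.
have t0 : diffop (twist 1 (fun=> 0) (fun=> 1) : endo k uY).
  by rewrite twist1; exact: diffop_1.
rewrite (row_sum_delta v); apply: (big_ind _ t0 tD) => j _.
have tn (d : 'rV_s) n : diffop (twist 1 (fun=> d) (fun=> 1) : endo k uY) ->
    diffop (twist 1 (fun=> d *+ n) (fun=> 1) : endo k uY).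
  by move=> hd; elim: n => [|n IH]; rewrite ?mulr0n ?mulrS //; apply: tD.
rewrite -[v 0 j]intz scaler_int; case: (v 0 j) => n; rewrite ?NegzE.
  by rewrite -pmulrn; apply: tn; rewrite twist_opQ_W; constructor.
rewrite mulrNz -mulNrz -pmulrn; apply: tn; rewrite twist_opQV_W; constructor.
by rewrite /unitsY leq_addr.
Qed.

Lemma diffop_twist_poly q : polyfun q ->
  diffop (twist 1 (fun=> 0) q : endo k uY).
Proof.
elim=> [c|j|f g _ df _ dg|f g _ df _ dg].
- by rewrite twist_const twist1; apply/diffopZ/diffop_1.
- by rewrite twist_euler_W; apply: diffop_mul; constructor.
- rewrite (_ : twist _ _ _ = twist 1 (fun=> 0) f + twist 1 (fun=> 0) g).
    exact: diffopD.
  by apply/esym/twistP => e v e' v'; rewrite cfD !cf_twist !mulrDl.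
- rewrite (_ : twist _ _ _ = twist 1 (fun=> 0) f * twist 1 (fun=> 0) g).
    exact: diffop_mul.
  rewrite twistM_const addr0 mulr1; congr twist; apply/funext => x.
  by rewrite map_mx0 addr0 mulrC.
Qed.

Lemma twist_factor D v q : twist D (fun=> v) q =
  twist D (fun=> v) (fun=> 1) * twist 1 (fun=> 0) q.
Proof.
rewrite twistM_const mulr1 addr0; congr twist; apply/funext => x.
by rewrite mulr1.
Qed.

Lemma twist_factorV D v : twist D (fun=> v) (fun=> 1) =
  twist D (fun=> 0) (fun=> 1) * twist 1 (fun=> v) (fun=> 1) :> endo k uY.
Proof. by rewrite twistM_const !mulr1 add0r. Qed.

(** The operator factors as a copy of [D], a power of Q_W and a polynomial in the operators
    theta_j. *)
Lemma diffop_twist D v q : diffop D -> polyfun q ->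
  diffop (twist D (fun=> v) q).
Proof.
move=> dD pq; rewrite twist_factor twist_factorV; apply: diffop_mul.
  by apply: diffop_mul; [exact: diffop_twistV | exact: diffop_twistW].
exact: diffop_twist_poly.
Qed.

Inductive twist_sum : endo k uY -> Prop :=
| twist_sum_in D d v q : diffop D -> weight D d -> polyfun q ->
    twist_sum (twist D (fun=> v) q)
| twist_sum0 : twist_sum 0
| twist_sumD F F' : twist_sum F -> twist_sum F' -> twist_sum (F + F').

Lemma twist_sumM F F' : twist_sum F -> twist_sum F' -> twist_sum (F * F').
Proof.
elim=> [D d v q dD wD pq||{}F E _ IHF _ IHE].
- elim=> [D' d' v' q' dD' wD' pq'||{}F' E' _ IHF' _ IHE'].
  + rewrite twistM_const; apply: twist_sum_in (weightM wD wD') _.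
      exact: diffop_mul.
    by apply: polyfunM => //; apply: polyfun_shift.
  + by rewrite mulr0; exact: twist_sum0.
  + by rewrite mulrDr; apply: twist_sumD; auto.
- by rewrite mul0r => _; exact: twist_sum0.
- by move=> hF'; rewrite mulrDl; apply: twist_sumD; auto.
Qed.

Lemma twist_sumZ a F : twist_sum F -> twist_sum (a *: F).
Proof.
elim=> [D d v q dD wD pq||{}F E _ IHF _ IHE].
- rewrite (_ : a *: _ = twist (a *: D) (fun=> v) q).
    exact: (twist_sum_in _ (diffopZ _ dD) (weightZ wD)).
  by apply: twistP => e w e' w'; rewrite !cfZ cf_twist mulrA mulrCA.
- by rewrite scaler0; exact: twist_sum0.
- by rewrite scalerDr; exact: twist_sumD.
Qed.

(** The generators have this shape, with P_(r+j) equal to Q_(r+j)^-1 theta_j, and products keep it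
    because moving q(theta) past a power of Q_W only translates q. *)
Lemma diffop_twist_sum (F : endo k uY) : diffop F -> twist_sum F.
Proof.
have in1 D v q d : diffop D -> weight D d -> polyfun q ->
  twist_sum (twist D (fun=> v) q) by exact: twist_sum_in.
elim=> [i|i ui|i||a {}F E _ sF _ sE|{}F E _ sF _ sE].
- case: (split_ordP i) => j ->.
    rewrite -twist_opQ; apply: (in1 _ _ _ (delta_mx 0 j)).
    + exact: diffop_Q.
    + exact: weight_opQ.
    + exact: polyfun_const.
  rewrite -twist_opQ_W; apply: (in1 _ _ _ 0).
  + exact: diffop_1.
  + exact: weight1.
  + exact: polyfun_const.
- move: ui; case: (split_ordP i) => j -> ui.
    by move: ui; rewrite /unitsY /= leqNgt ltn_ord.
  rewrite -twist_opQV_W; apply: (in1 _ _ _ 0).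
  + exact: diffop_1.
  + exact: weight1.
  + exact: polyfun_const.
- case: (split_ordP i) => j ->.
    rewrite -twist_opP; apply: (in1 _ _ _ (- delta_mx 0 j)).
    + exact: diffop_P.
    + exact: weight_opP.
    + exact: polyfun_const.
  rewrite -twist_opP_W; apply: (in1 _ _ _ 0).
  + exact: diffop_1.
  + exact: weight1.
  + exact: polyfun_coord.
- rewrite -twist1; apply: (in1 _ _ _ 0).
  + exact: diffop_1.
  + exact: weight1.
  + exact: polyfun_const.
- by apply: twist_sumD => //; exact: twist_sumZ.
- exact: twist_sumM.
Qed.

End Twist.

(** * The homomorphism and its retractions *)

HB.lock Definition diag_op (k : fieldType) (n : nat) (u : pred 'I_n)
    (f : expo u -> k) : endo k u := Endo (linext (fun e => f e *: mono_expo e)).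
Arguments diag_op {k n u}.

Section DiagonalOperators.
Variables (k : fieldType) (n : nat) (u : pred 'I_n).
Implicit Types (f g : expo u -> k) (D : endo k u).

Lemma diag_op_mono f e : diag_op f (mono_expo e) = f e *: mono_expo e.
Proof. by rewrite diag_op.unlock [LHS]linextU. Qed.

Lemma cf_diag_op f e e' : cf (diag_op f) e e' = f e * (e == e')%:R.
Proof. by rewrite cfE diag_op_mono mcoeffZ mcoeff_mono_expo. Qed.

Lemma cf_mul_diag_op D f e e' : cf (D * diag_op f) e e' = f e * cf D e e'.
Proof. by rewrite !cfE endoM diag_op_mono linearZ mcoeffZ. Qed.

Lemma mcoeff_diag_op f p e : mcoeff e (diag_op f p) = f e * mcoeff e p.
Proof.
move: p; apply: coordring_ind => [|e'|a p q IHp IHq].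
- by rewrite linear0 !mcoeff0 mulr0.
- rewrite diag_op_mono mcoeffZ !mcoeff_mono_expo.
  by have [->|] := eqVneq e' e; rewrite ?mulr0.
- rewrite linearP [LHS]mcoeff_lin [mcoeff e (_ + _)]mcoeff_lin mulrDr mulrCA.
  exact: (congr2 (fun x y => a * x + y) IHp IHq).
Qed.

Lemma cf_diag_op_mul D f e e' : cf (diag_op f * D) e e' = f e' * cf D e e'.
Proof. by rewrite !cfE endoM mcoeff_diag_op. Qed.

Lemma diag_op1 : diag_op (fun=> 1) = 1 :> endo k u.
Proof. by apply: cfP => e e'; rewrite cf_diag_op mul1r cf1. Qed.

Lemma opQ_opP_mono_expo i (e : expo u) :
  (opQ k u i * opP k u i) (mono_expo e) = (e 0 i)%:~R *: mono_expo e.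
Proof.
have eE : mono (expo_val e) = mono_expo e :> coordring k u.
  by rewrite (monoE k (expoP e)); case: e.
rewrite endoM opP_mono_expo linearZ /=.
have [->|nz] := eqVneq ((expo_val e) 0 i) 0; first by rewrite !scale0r.
congr (_ *: _); rewrite opQ_mono ?subrK //.
rewrite orbC !mxE !eqxx; case: (u i) (forallP (expoP e) i) => //= e0.
by rewrite subr_ge0 -gtz0_ge1 lt0r nz e0.
Qed.

Lemma cf_euler (K : {pred torus k n}) (x : 'rV[k]_n) e e' :
  cf (euler u K x) e e' = (\sum_i x 0 i * (expo_val e 0 i)%:~R) * (e == e')%:R.
Proof.
rewrite [euler _ _ _ : endo k u]/= cf_sum mulr_suml; apply: eq_bigr => i _.
rewrite cfZ cfE opQ_opP_mono_expo mcoeffZ mcoeff_mono_expo.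
by rewrite mulrA.
Qed.

Lemma weight_euler (K : {pred torus k n}) x : weight (euler u K x) 0.
Proof.
move=> e e'; rewrite cf_euler mulf_eq0 negb_or natrb_neq0 addr0.
by case/andP=> _ /eqP->.
Qed.

End DiagonalOperators.

Lemma mulrB_split (R : pzRingType) (x y x' y' : R) :
  x * y - x' * y' = (x - x') * y + x' * (y - y').
Proof. by rewrite mulrBl mulrBr addrA subrK. Qed.

Section Reduction.
Variables (k : closedFieldType) (char0 : [pchar k] =i pred0).
Variables (r s : nat) (G : {pred torus k (r + s)}).
Hypotheses (hG : diagonal_torus G) (hW : transitive_W G).
Variable w : torus k s.
Let H := stab G w.
Local Notation uV := (@unitsV r).
Local Notation uY := (@unitsY r s).
Local Notation HV := (image_V H).
Implicit Types (a : 'rV[int]_r) (b : 'rV[int]_s).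

(** The companion b of [a], chosen classically; the default 0 is harmless because nonzero entries of
    [H]-invariant operators involve only characters having a companion. *)
Definition shift_W a : 'rV[int]_s :=
  if pselect (exists b, trivial_on G (row_mx a b)) is left h
  then projT1 (cid h) else 0.

Lemma shift_WP a b : trivial_on G (row_mx a b) -> shift_W a = b.
Proof.
move=> ab; rewrite /shift_W; case: pselect => [h|]; last by case; exists b.
case: cid => b' /= ab'; apply/eqP; rewrite -subr_eq0; apply/eqP.
apply: (trivial_on_W char0 hG hW).
have -> : row_mx 0 (b' - b) = row_mx a b' - row_mx a b.
  by rewrite opp_row_mx add_row_mx subrr.
exact: trivial_onB.
Qed.

Lemma trivial_on_shift_W a :
  trivial_on HV a -> trivial_on G (row_mx a (shift_W a)).
Proof.
by move/(stab_trivial_lift char0 hG hW)=> [b ab]; rewrite (shift_WP ab).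
Qed.

Lemma shift_W0 : shift_W 0 = 0.
Proof. by apply: shift_WP; rewrite row_mx0; exact: trivial_on0. Qed.

Lemma shift_WD a a' : trivial_on HV a -> trivial_on HV a' ->
  shift_W (a + a') = shift_W a + shift_W a'.
Proof.
move=> /trivial_on_shift_W ha /trivial_on_shift_W ha'; apply: shift_WP.
by rewrite -add_row_mx; apply: trivial_onD.
Qed.

Definition xi_op (D : endo k uV) : endo k uY := twist D shift_W (fun=> 1).

Lemma xi_op_linear : linear xi_op. Proof. exact: twist_linear. Qed.

Lemma xi_op0 : xi_op 0 = 0.
Proof. by apply/esym/twistP => *; rewrite !cf0 mulr0 mul0r. Qed.

Lemma xi_opD D E : xi_op (D + E) = xi_op D + xi_op E.
Proof. by rewrite -{1}[D]scale1r xi_op_linear scale1r. Qed.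

Lemma xi_op_weight D d :
  weight D d -> xi_op D = twist D (fun=> shift_W d) (fun=> 1).
Proof. exact: twist_weight. Qed.

Lemma diffop_xi_op D : homog_sum (trivial_on HV) D -> diffop (xi_op D).
Proof.
elim=> [{}D d dH dD wD||{}D E _ IHD _ IHE].
- rewrite (xi_op_weight wD); apply: diffop_twist => //.
  exact: polyfun_const.
- by rewrite xi_op0; exact: diffop0.
- by rewrite xi_opD; exact: diffopD.
Qed.

Lemma xi_op_inv D : D \in @inv_pred k r uV HV -> xi_op D \in @inv_pred k _ uY G.
Proof.
move=> hD; apply: inv_predP; first exact/diffop_xi_op/diffop_inv_homog_sum.
move=> E E'; rewrite (expo_pair_eta E) (expo_pair_eta E') cf_twist mul1r.
rewrite mulf_eq0 negb_or natrb_neq0 => /andP[nz /eqP->] /=.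
rewrite opp_row_mx add_row_mx [expo_W E + _]addrC addrK.
exact/trivial_on_shift_W/(cf_inv_trivial hD nz).
Qed.

Definition xi (D : DV_inv H) : DY_inv G := DiffopInv (xi_op_inv (invP D)).

Fact xi_linear : linear xi.
Proof. by move=> a D E; apply: val_inj; exact: xi_op_linear. Qed.

Fact xi_monoid_morphism : monoid_morphism xi.
Proof.
split=> [|D E]; apply: val_inj => /=.
  rewrite (xi_op_weight (@weight1 k r uV)) shift_W0.
  exact: twist1.
apply/esym/twistM => [e e' e'' nE nD|*]; last by rewrite mulr1.
rewrite -shift_WD; first by congr shift_W; rewrite [RHS]addrC addrA subrK.
  exact: cf_inv_trivial (invP E) nE.
exact: cf_inv_trivial (invP D) nD.
Qed.

HB.instance Definition _ :=
  GRing.isLinear.Build k (DV_inv H) (DY_inv G) _ xi xi_linear.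
HB.instance Definition _ :=
  GRing.isMonoidMorphism.Build (DV_inv H) (DY_inv G) xi xi_monoid_morphism.

(** The entries of [D] are read off from those of its image at [v = 0]. *)
Lemma xi_injective : injective xi.
Proof.
move=> D E /(congr1 val) DE; apply/val_inj/cfP => e e'.
have xiE (F : endo k uV) : cf F e e' = cf (xi_op F) (expo_pair e 0)
    (expo_pair e' (shift_W (expo_val e' - expo_val e))).
  by rewrite cf_twist mul1r add0r eqxx mulr1.
by rewrite xiE [RHS]xiE; congr (cf _ _ _).
Qed.

Definition xi_lrmorphism : {lrmorphism DV_inv H -> DY_inv G} := xi.

Lemma moment_Y_twist (x : lie G) : val (moment_Y x) =
  twist (val (euler uV HV (lsubmx (val x)))) (fun=> 0) (fun=> 1) +
  twist 1 (fun=> 0) (fun y => \sum_j val x 0 (rshift r j) * y 0 j).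
Proof.
apply: cfP => E E'; rewrite (expo_pair_eta E) (expo_pair_eta E').
rewrite cf_euler cfD !cf_twist mul1r cf_euler cf1 addr0 -!mulrA -natrM.
rewrite expo_pair_eq [expo_W E' == _]eq_sym mulnb -mulrDl; congr (_ * _).
rewrite big_split_ord /=; congr (_ + _); apply: eq_bigr => i _.
  by rewrite row_mxEl !mxE.
by rewrite row_mxEr [in RHS]mxE.
Qed.

(** * The retraction attached to lambda *)

Section Character.
Variables (lambda : {scalar lie G}) (x_ : 'I_s -> lie G).
Hypothesis x_W : forall j, rsubmx (x_ j : 'rV_(r + s)) = delta_mx 0 j.

(* Modulo g - lambda(g), the operator Q_(r+j) P_(r+j) is equal to             *)
(* lambda(x_j) - sum_(i <= r) d eta_i(x_j) Q_i P_i in D(V), whose value on    *)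
(* Q_V^e is the j-th coordinate of euler_value e.                             *)
Definition euler_value (e : expo uV) : 'rV[k]_s :=
  \row_j (lambda (x_ j) -
    \sum_i (expo_val e 0 i)%:~R * val (x_ j) 0 (lshift s i)).

(** The differential of (a, b) vanishes on [x_ j], so the V-part of [x_ j] pairs with [a] to minus
    the j-th entry of [b]. Thus [euler_value] moves exactly as the exponent [v] of Q_W does. *)
Lemma euler_value_shift (e e' : expo uV) a b :
  expo_val e' = expo_val e + a -> trivial_on G (row_mx a b) ->
  euler_value e' = euler_value e + map_mx intr b.
Proof.
move=> e'E ab; apply/rowP => j; rewrite !mxE -addrA; congr (_ + _).
under eq_bigr => i _ do rewrite e'E mxE intrD mulrDl.
rewrite big_split opprD /=; congr (_ + _).
rewrite (lie_trivial char0 hG hW (lieP (x_ j)) ab) opprK.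
have xj l : val (x_ j) 0 (rshift r l) = (l == j)%:R.
  by have /rowP/(_ l) := x_W j; rewrite !mxE eqxx.
rewrite (bigD1 j) //= xj eqxx mulr1 big1 ?addr0 // => l /negPf lj.
by rewrite xj lj mulr0.
Qed.

(* F acts on Q_V^e Q_W^v with coefficients polynomial in v, and D is obtained *)
(* by forgetting Q_W and specializing v to euler_value e; since a polynomial  *)
(* vanishing on Z^s is 0, F determines D.                                     *)
Inductive nf : endo k uY -> endo k uV -> Prop :=
| nf_in D d b q : weight D d -> trivial_on G (row_mx d b) -> polyfun q ->
    nf (twist D (fun=> b) q) (D * diag_op (q \o euler_value))
| nf0 : nf 0 0
| nfD F F' D D' : nf F D -> nf F' D' -> nf (F + F') (D + D').

Lemma nfZ c F D : nf F D -> nf (c *: F) (c *: D).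
Proof.
elim=> [{}D d b q wD db pq||{}F F' {}D D' _ IH _ IH'].
- rewrite scalerAl (_ : c *: twist _ _ _ = twist (c *: D) (fun=> b) q).
    exact: nf_in (weightZ wD) db pq.
  by apply: twistP => *; rewrite !cfZ cf_twist mulrA mulrCA.
- by rewrite !scaler0; exact: nf0.
- by rewrite !scalerDr; exact: nfD.
Qed.

(** Specialization at [euler_value] respects products because the translation of [q] by [b'] on the
    side of Y matches [euler_value_shift] on the side of V. *)
Lemma nfM F D F' D' : nf F D -> nf F' D' -> nf (F * F') (D * D').
Proof.
elim=> [{}D d b q wD db pq||{}F F1 {}D D1 _ IH _ IH1].
- elim=> [{}D' d' b' q' wD' db' pq'||{}F' F1 {}D' D1 _ IH _ IH1].
  + rewrite twistM_const (_ : D * _ * _ = (D * D') * diag_op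
      ((fun x => q' x * q (x + map_mx intr b')) \o euler_value)).
      apply: nf_in (weightM wD wD') _ _; first by rewrite -add_row_mx; exact: trivial_onD.
      by apply: polyfunM => //; exact: polyfun_shift.
    rewrite -!mulrA; congr (_ * _); apply: cfP => e e'.
    rewrite cf_diag_op_mul !cf_mul_diag_op /=.
    have [->|/wD' e'E] := eqVneq (cf D' e e') 0; first by rewrite !mulr0.
    by rewrite (euler_value_shift e'E db') mulrA [q _ * _]mulrC.
  + by rewrite !mulr0; exact: nf0.
  + by rewrite !mulrDr; exact: nfD.
- by rewrite !mul0r => _; exact: nf0.
- by move=> h; rewrite !mulrDl; apply: nfD; auto.
Qed.

(** One polynomial [q] interpolates the entries of [F] at integral [v] and gives the entry of [D] at
    [euler_value e]; the last clause covers differences without companion. *)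
Lemma nf_cf F D (e e' : expo uV) : nf F D -> exists q,
  [/\ polyfun q,
      forall b, trivial_on G (row_mx (expo_val e' - expo_val e) b) ->
        forall v, cf F (expo_pair e v) (expo_pair e' (v + b)) = q (map_mx intr v),
      cf D e e' = q (euler_value e)
    & (forall b, ~ trivial_on G (row_mx (expo_val e' - expo_val e) b)) ->
        cf D e e' = 0].
Proof.
elim=> [{}D d b q wD db pq||{}F F' {}D D' _ [q [pq Fq Dq D0]] _ [q' [pq' Fq' Dq' D0']]].
- exists (fun x => q x * cf D e e'); split.
  + exact: polyfunM pq (polyfun_const _ _).
  + move=> b' db' v; rewrite cf_twist.
    have [->|/wD e'E] := eqVneq (cf D e e') 0; first by rewrite mulr0 mul0r.
    move: db'; rewrite e'E addrAC subrr add0r => /shift_WP <-.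
    by rewrite (shift_WP db) eqxx mulr1.
  + by rewrite cf_mul_diag_op.
  + move=> h; rewrite cf_mul_diag_op.
    have [->|/wD e'E] := eqVneq (cf D e e') 0; first by rewrite mulr0.
    by case: (h b); rewrite e'E addrAC subrr add0r.
- exists (fun=> 0); split=> [|*||*]; rewrite ?cf0 //; exact: polyfun_const.
- exists (fun x => q x + q' x); split=> [|b hb v||hb].
  + exact: polyfunD.
  + by rewrite cfD Fq // Fq'.
  + by rewrite cfD Dq Dq'.
  + by rewrite cfD D0 // D0' // addr0.
Qed.

Lemma nf_functional D : nf 0 D -> D = 0.
Proof.
move=> nD; apply: cfP => e e'; rewrite cf0.
have [q [pq Fq Dq D0]] := nf_cf e e' nD.
have [[b hb]|/forallNP nb] :=
  pselect (exists b, trivial_on G (row_mx (expo_val e' - expo_val e) b)).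
  rewrite Dq; apply: (polyfun_eq0 char0 pq) => v.
  by rewrite -(Fq b hb) cf0.
exact: D0.
Qed.

Lemma nf_xi_op D : homog_sum (trivial_on HV) D -> nf (xi_op D) D.
Proof.
elim=> [{}D d dH dD wD||{}D D' _ IH _ IH'].
- rewrite (xi_op_weight wD) -[X in nf _ X]mulr1 -(diag_op1 _ uV).
  apply: (nf_in wD (trivial_on_shift_W dH) (q := fun=> 1)).
  exact: polyfun_const.
- by rewrite xi_op0; exact: nf0.
- by rewrite xi_opD; exact: nfD.
Qed.

(* The graph of the retraction of xi that maps x_j to lambda(x_j).            *)
Inductive rel : DY_inv G -> DV_inv H -> Prop :=
| rel_xi D : rel (xi D) D
| rel_moment j : rel (moment_Y (x_ j)) (lambda (x_ j))%:A
| rel_lin c F F' D D' : rel F D -> rel F' D' -> rel (c *: F + F') (c *: D + D')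
| relM F F' D D' : rel F D -> rel F' D' -> rel (F * F') (D * D').

(** For [x_ j] the moment acts on Q_V^e Q_W^v by a scalar affine in [v], and [euler_value e] is
    precisely the point where that scalar is [lambda (x_ j)]. *)
Lemma rel_nf F D : rel F D -> nf (val F) (val D).
Proof.
elim=> [{}D|j|c {}F F' {}D D' _ IH _ IH'|{}F F' {}D D' _ IH _ IH'].
- exact/nf_xi_op/diffop_inv_homog_sum/(invP D).
- set q := fun y : 'rV_s => \sum_l val (x_ j) 0 (rshift r l) * y 0 l.
  pose D0 : endo k uV := val (euler uV HV (lsubmx (val (x_ j)))).
  have pq : polyfun q.
    by apply: polyfun_sum => l; apply: polyfunM; constructor.
  have wD0 : weight D0 0 by exact: weight_euler.
  have t0 : trivial_on G (row_mx 0 0) by rewrite row_mx0; exact: trivial_on0.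
  rewrite moment_Y_twist -/q (_ : val (lambda (x_ j))%:A =
    D0 * diag_op ((fun=> 1) \o euler_value) + 1 * diag_op (q \o euler_value)).
    apply: nfD; first exact: nf_in wD0 t0 (polyfun_const _ 1).
    exact: nf_in (@weight1 k r uV) t0 pq.
  apply: cfP => e e'.
  rewrite [LHS]cfZ cfD !cf_mul_diag_op cf1 /= mul1r cf_euler -mulrDl.
  congr (_ * _); rewrite /q (bigD1 j) //= [X in _ + (_ + X)]big1 => [|l /negPf lj].
    have -> : val (x_ j) 0 (rshift r j) = 1.
      by have /rowP/(_ j) := x_W j; rewrite !mxE !eqxx.
    rewrite mul1r addr0 mxE addrC -[LHS](subrK (\sum_i (expo_val e 0 i)%:~R *
      val (x_ j) 0 (lshift s i))); congr (_ + _).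
    by apply: eq_bigr => i _; rewrite mxE mulrC.
  have -> : val (x_ j) 0 (rshift r l) = 0.
    by have /rowP/(_ l) := x_W j; rewrite !mxE eqxx lj.
  by rewrite mul0r.
- exact: nfD (nfZ c IH) IH'.
- exact: nfM IH IH'.
Qed.

Lemma rel0 : rel 0 0.
Proof. by rewrite -{1}(linear0 xi); exact: rel_xi. Qed.

Lemma relD F F' D D' : rel F D -> rel F' D' -> rel (F + F') (D + D').
Proof. by rewrite -{2}[F]scale1r -{2}[D]scale1r; exact: rel_lin. Qed.

Lemma relZ c F D : rel F D -> rel (c *: F) (c *: D).
Proof.
by rewrite -[c *: F]addr0 -[c *: D]addr0 => h; apply: rel_lin => //; exact: rel0.
Qed.

Lemma relB F F' D D' : rel F D -> rel F' D' -> rel (F - F') (D - D').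
Proof.
move=> h h'; rewrite -(scaleN1r F') -(scaleN1r D').
by apply: relD => //; exact: relZ.
Qed.

Lemma rel_scalar c : rel c%:A c%:A.
Proof. by apply: relZ; rewrite -{1}(rmorph1 xi); exact: rel_xi. Qed.

Lemma rel_functional F D D' : rel F D -> rel F D' -> D = D'.
Proof.
move=> h h'; apply/eqP; rewrite -subr_eq0; apply/eqP/val_inj.
have /rel_nf := relB h h'; rewrite subrr => n0.
exact: nf_functional n0.
Qed.

Lemma rel_mod_ideal F D :
  rel F D -> ideal_gen (shifted_Y lambda) (F - xi D).
Proof.
elim=> [{}D|j|c {}F F' {}D D' _ IH _ IH'|{}F F' {}D D' _ IH _ IH'].
- by rewrite subrr; exact: ideal_gen_0.
- by rewrite linearZ rmorph1; apply: ideal_gen_in; exists (x_ j).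
- rewrite linearP opprD addrACA -scalerBr.
  by apply: ideal_gen_D => //; exact: ideal_gen_Z.
- rewrite rmorphM mulrB_split.
  by apply: ideal_gen_D; [exact: ideal_gen_Mr | exact: ideal_gen_Ml].
Qed.

(** The moment of [x_ j] minus the image under [xi] of its V-part is theta_j, so all polynomials in
    the theta_j are in the domain of the retraction. *)
Lemma rel_polyfun q : polyfun q ->
  exists F D, rel F D /\ val F = twist 1 (fun=> 0) q.
Proof.
elim=> [c|j|f g _ [F [D [h Ff]]] _ [F' [D' [h' Fg]]]
  |f g _ [F [D [h Ff]]] _ [F' [D' [h' Fg]]]].
- exists c%:A, c%:A; split; first exact: rel_scalar.
  by rewrite twist_const twist1.
- pose D0 : DV_inv H := euler uV HV (lsubmx (val (x_ j))).
  exists (moment_Y (x_ j) - xi D0), ((lambda (x_ j))%:A - D0); split.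
    by apply: relB; [exact: rel_moment | exact: rel_xi].
  rewrite [LHS](_ : _ = val (moment_Y (x_ j)) - xi_op (val D0)) //.
  rewrite moment_Y_twist (xi_op_weight (@weight_euler _ _ _ _ _)) shift_W0.
  rewrite addrC addKr; congr twist; apply/funext => y.
  rewrite (bigD1 j) //= big1 ?addr0 => [|l /negPf lj].
    have -> : val (x_ j) 0 (rshift r j) = 1.
      by have /rowP/(_ j) := x_W j; rewrite !mxE !eqxx.
    by rewrite mul1r.
  have -> : val (x_ j) 0 (rshift r l) = 0.
    by have /rowP/(_ l) := x_W j; rewrite !mxE eqxx lj.
  by rewrite mul0r.
- exists (F + F'), (D + D'); split; first exact: relD.
  rewrite [LHS](_ : _ = val F + val F') // Ff Fg.
  by apply: twistP => *; rewrite cfD !cf_twist !mulrDl.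
- exists (F * F'), (D * D'); split; first exact: relM.
  rewrite [LHS](_ : _ = val F * val F') // Ff Fg twistM_const addr0 mulr1.
  congr twist; apply/funext => y.
  by rewrite map_mx0 addr0 mulrC.
Qed.

(** The terms of an invariant sum need not be invariant themselves. Each has a single weight: it is
    xi(D) q(theta) if that weight is trivial on [G], and is discarded otherwise. *)
Lemma twist_sum_rel F : twist_sum F -> exists F' D', rel F' D' /\
  forall e e', cf (val F') e e' =
    if `[< trivial_on G (expo_val e' - expo_val e) >] then cf F e e' else 0.
Proof.
elim=> [D d b q dD wD pq||{}F E _ [F' [D' [h hF]]] _ [E' [D'' [h' hE]]]].
- have wF e e' : cf (twist D (fun=> b) q) e e' != 0 ->
      expo_val e' - expo_val e = row_mx d b.
    rewrite (expo_pair_eta e) (expo_pair_eta e') cf_twist !mulf_eq0 !negb_or.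
    rewrite natrb_neq0 => /andP[/andP[_ /wD e'E] /eqP bE].
    rewrite !expo_pairE opp_row_mx add_row_mx e'E bE.
    by rewrite ![_ + _ - _]addrAC !subrr !add0r.
  have [db|ndb] := pselect (trivial_on G (row_mx d b)); last first.
    exists 0, 0; split=> [|e e']; first exact: rel0.
    rewrite [val 0](_ : _ = 0) // cf0; case: asboolP => // he; apply/esym/eqP.
    by apply: contra_notT ndb => /wF <-.
  have dH : trivial_on HV d.
    exact: (trivial_on_stab (w := w) db).
  pose D1 : DV_inv H := DiffopInv (weight_inv dD wD dH).
  have [T [D2 [hT TE]]] := rel_polyfun pq.
  exists (xi D1 * T), (D1 * D2); split=> [|e e'].
    by apply: relM => //; exact: rel_xi.
  have -> : val (xi D1 * T) = twist D (fun=> b) q.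
    rewrite [LHS](_ : _ = xi_op D * val T) // TE (xi_op_weight wD).
    by rewrite (shift_WP db) [RHS]twist_factor.
  case: asboolP => // ne; apply/eqP; apply: contra_notT ne => /wF ->.
  exact: db.
- exists 0, 0; split=> [|e e']; first exact: rel0.
  by rewrite [val 0](_ : _ = 0) // cf0; case: ifP.
- exists (F' + E'), (D' + D''); split=> [|e e']; first exact: relD.
  rewrite [val _](_ : _ = val F' + val E') // !cfD hF hE.
  by case: ifP; rewrite ?addr0.
Qed.

Lemma rel_total F : exists D, rel F D.
Proof.
have /asboolP[dF _] := invP F.
have [F' [D [h hF]]] := twist_sum_rel (diffop_twist_sum dF).
exists D; suff -> : F = F' by [].
apply/val_inj/cfP => e e'; rewrite hF; case: asboolP => // ne.
apply/eqP; apply: contra_notT ne; exact: cf_inv_trivial (invP F).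
Qed.

Lemma moment_Y_xi (y : lie H) :
  moment_Y (lie_incl (@stab_sub k r s G w) y) = xi (moment_V y).
Proof.
have [_ yW] := (lie_stabP char0 hG hW w (val y)).1 (lieP y).
apply: val_inj; rewrite moment_Y_twist.
rewrite [RHS](_ : _ = xi_op (val (moment_V y))) //.
rewrite (xi_op_weight (@weight_euler _ _ _ _ _)) shift_W0.
rewrite [X in _ + X](_ : _ = 0) ?addr0 //; apply/esym/twistP => *.
rewrite cf0 big1 ?mul0r // => j _.
have -> : val (lie_incl (@stab_sub k r s G w) y) 0 (rshift r j) = 0.
  by have /rowP/(_ j) := yW; rewrite !mxE.
by rewrite mul0r.
Qed.

Let mu := lie_res (@stab_sub k r s G w) lambda.

Lemma xi_ideal D :
  ideal_gen (shifted_V mu) D -> ideal_gen (shifted_Y lambda) (xi D).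
Proof.
elim=> [{}D [y ->]||D1 D2 _ IH1 _ IH2|D1 {}D D2 _ IH].
- rewrite linearB linearZ rmorph1 /= -moment_Y_xi; apply: ideal_gen_in.
  by exists (lie_incl (@stab_sub k r s G w) y).
- by rewrite linear0; exact: ideal_gen_0.
- by rewrite linearD; exact: ideal_gen_D.
- by rewrite !rmorphM; exact: ideal_gen_M.
Qed.

Lemma moment_Y_linear : linear (@moment_Y k r s G).
Proof.
move=> c x y; apply: val_inj; rewrite [RHS](_ : _ =
  c *: val (moment_Y x) + val (moment_Y y)) // scaler_sumr -big_split /=.
by apply: eq_bigr => i _; rewrite !mxE scalerDl scalerA.
Qed.

(** The statement is linear in [x], and Lie(G) is spanned by the [x_ j] and Lie(H). On [x_ j] the
    retraction gives 0; on Lie(H), where the moment is in the image of [xi], it gives a generator of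
    the ideal of [mu]. *)
Lemma rel_shifted_Y (x : lie G) : exists2 D,
  rel (moment_Y x - (lambda x)%:A) D & ideal_gen (shifted_V mu) D.
Proof.
pose P (x : lie G) := exists2 D,
  rel (moment_Y x - (lambda x)%:A) D & ideal_gen (shifted_V mu) D.
rewrite -/(P x).
have Plin c y z : P y -> P z -> P (c *: y + z).
  move=> [D h i] [D' h' i']; exists (c *: D + D'); last first.
    by apply: ideal_gen_D => //; exact: ideal_gen_Z.
  rewrite moment_Y_linear linearP scalerDl -scalerA opprD addrACA -scalerBr.
  exact: rel_lin.
have P0 : P 0.
  exists 0; last exact: ideal_gen_0.
  rewrite linear0 scale0r subr0 (_ : moment_Y 0 = 0); first exact: rel0.
  by have := moment_Y_linear (-1) 0 0; rewrite !scaleN1r !addNr.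
have Px j : P (x_ j).
  exists 0; last exact: ideal_gen_0.
  rewrite -(subrr (lambda (x_ j))%:A).
  by apply: relB; [exact: rel_moment | exact: rel_scalar].
(* The W-parts of the [x_ j] are the standard basis, so [x - sx] has no W-part and lies in
   Lie(H). *)
pose sx := \sum_j val x 0 (rshift r j) *: x_ j.
have Psx : P sx.
  apply: big_ind => // [y z Py Pz|j _]; first by rewrite -[y]scale1r; exact: Plin.
  by rewrite -[_ *: _]addr0; exact: Plin.
have sxE : val sx = \sum_j val x 0 (rshift r j) *: val (x_ j).
  by rewrite linear_sum; apply: eq_bigr => j _; rewrite linearZ.
have xW : rsubmx (val (x - sx)) = 0.
  apply/rowP => l; rewrite linearB /= sxE !mxE summxE (bigD1 l) //=.
  rewrite big1 => [|j /negPf jl].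
    by have /rowP/(_ l) := x_W l; rewrite !mxE !eqxx => ->; rewrite mulr1 addr0 subrr.
  have /rowP/(_ l) := x_W j; rewrite !mxE eqxx eq_sym jl => ->.
  by rewrite mulr0.
pose y : lie H := Lie ((lie_stabP char0 hG hW w _).2 (conj (lieP (x - sx)) xW)).
have -> : x = 1 *: lie_incl (@stab_sub k r s G w) y + sx.
  rewrite scale1r (_ : lie_incl _ y = x - sx) ?subrK //.
  exact: val_inj.
apply: Plin => //; exists (moment_V y - (mu y)%:A).
  by rewrite moment_Y_xi; apply: relB; [exact: rel_xi | exact: rel_scalar].
by apply: ideal_gen_in; exists y.
Qed.

Lemma rel_ideal F : ideal_gen (shifted_Y lambda) F ->
  exists2 D, rel F D & ideal_gen (shifted_V mu) D.
Proof.
elim=> [{}F [x ->]||F1 F2 _ [D1 h1 i1] _ [D2 h2 i2]|F1 {}F F2 _ [D h i]].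
- exact: rel_shifted_Y.
- by exists 0; [exact: rel0 | exact: ideal_gen_0].
- by exists (D1 + D2); [exact: relD | exact: ideal_gen_D].
- have [D1 h1] := rel_total F1; have [D2 h2] := rel_total F2.
  exists (D1 * D * D2); last exact: ideal_gen_M.
  by do 2![apply: relM => //].
Qed.

(** Apply the retraction to [xi D]: single-valuedness identifies the result with [D], and totality
    lets the retraction pass through two-sided multiples. *)
Lemma xi_ideal_inj D :
  ideal_gen (shifted_Y lambda) (xi D) -> ideal_gen (shifted_V mu) D.
Proof.
by move=> /rel_ideal[D' h]; rewrite (rel_functional (rel_xi D) h).
Qed.

End Character.

End Reduction.

(** * Induced maps of quotient algebras and the conclusion *)

Section QuotientMap.
Variables (k : fieldType) (A : algType k) (S : A -> Prop).

Lemma quot_pi_linear : linear (quot_pi S).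
Proof. by move=> a x y; rewrite -quot_addE -quot_scaleE. Qed.

Lemma quot_piM : {morph quot_pi S : x y / x * y}.
Proof. by move=> x y; rewrite -quot_mulE. Qed.

End QuotientMap.

Section QuotientIsomorphism.
Variables (k : fieldType) (A B : algType k) (S : A -> Prop) (S' : B -> Prop).

Lemma quot_alg_iso (f : {lrmorphism A -> B}) :
  (forall x, ideal_gen S x <-> ideal_gen S' (f x)) ->
  (forall y, exists x, ideal_gen S' (y - f x)) ->
  exists phi : quot_alg S -> quot_alg S',
    alg_iso phi /\ forall x, phi (quot_pi S x) = quot_pi S' (f x).
Proof.
move=> fS fsurj; exists (fun p => quot_pi S' (f (repr p))).
have phiE x : quot_pi S' (f (repr (quot_pi S x))) = quot_pi S' (f x).
  by apply/quot_piP; rewrite -linearB; apply/fS/quot_reprK.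
split=> //; split.
- move=> a p q; rewrite -[p]quot_piK -[q]quot_piK -(@quot_pi_linear k A S) !phiE.
  by rewrite linearP quot_pi_linear.
- split=> [|p q]; first by rewrite [1 in LHS](_ : 1 = quot_pi S 1) // phiE rmorph1.
  rewrite -[p]quot_piK -[q]quot_piK -(@quot_piM k A S) !phiE.
  by rewrite rmorphM quot_piM.
have /choice[g gP] y : exists x, quot_pi S' (f x) = quot_pi S' y.
  by have [x /quot_piP ->] := fsurj y; exists x.
exists (fun q => quot_pi S (g (repr q))) => [p|q]; last by rewrite phiE gP quot_piK.
rewrite -[RHS]quot_piK; apply/quot_piP/fS; rewrite linearB.
by apply/quot_piP; rewrite gP quot_piK.
Qed.

End QuotientIsomorphism.

Theorem propositionC (k : closedFieldType) (char0 : [pchar k] =i pred0)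
    (r s : nat) (G : {pred torus k (r + s)}) (hG : diagonal_torus G)
    (hW : transitive_W G) (w : torus k s) :
  let H := stab G w in
  exists xi : {lrmorphism DV_inv H -> DY_inv G},
    injective xi /\
    forall lambda : {scalar lie G},
      let mu := lie_res (@stab_sub k r s G w) lambda in
      exists phi : B_V mu -> B_Y lambda,
        alg_iso phi /\
        forall D : DV_inv H,
          phi (quot_pi (shifted_V mu) D) = quot_pi (shifted_Y lambda) (xi D).
Proof.
move=> H; exists (xi_lrmorphism char0 hG hW w); split.
  exact: (xi_injective (char0 := char0) (hG := hG) (hW := hW) (w := w)).
move=> lambda mu.
have /choice[x_ x_W] j :
    exists x : lie G, rsubmx (x : 'rV_(r + s)) = delta_mx 0 j.
  exact: (lie_lift_W char0 hG hW).
apply: quot_alg_iso => [D|F].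
  split; first exact: xi_ideal.
  exact: (xi_ideal_inj x_W).
have [D hD] := rel_total char0 hG hW w lambda x_W F.
by exists D; exact: (rel_mod_ideal hD).
Qed.
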